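(* Let $a,b$ be positive integers with $a\le b$ and let $f^{a,b}_2(x,y,z,w)=ax^2+by^2+2(z^2+zw+w^2)$. If $f^{a,b}_2$ represents $1$ and $5$ (with integer arguments), then it represents every nonnegative integer. *)

(* Defs.v *)
From Stdlib Require Import ZArith.
Open Scope Z_scope.

Definition f2 (a b x y z w : Z) : Z :=
  a * x ^ 2 + b * y ^ 2 + 2 * (z ^ 2 + z * w + w ^ 2).

Definition represents (a b n : Z) : Prop :=
  exists x y z w : Z, f2 a b x y z w = n.

(* Main.v *)
(* Representing [1] and [5] forces [a = 1] and [b <= 5]. Write [T] for the ternary form
   [x^2 + 2 (z^2 + z w + w^2)]. Since [3 x^2 + 2 (p^2 + p q + q^2)] is the sum of the squares
   of [x + p], [x + q] and [x - p - q], the form [T] represents [t] as soon as [3 t] is a sum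
   of three squares, hence whenever [t] is 1, 2, 3, 6 or 7 modulo 8. If [n] is 5 modulo 8 then
   [n - b y^2] is in one of these classes for a suitable small [y], and multiples of 4 scale.

   For the three-square theorem, [N] is the leading 2 x 2 minor [q h - b^2] of the
   determinant-one form [q x^2 + 2 b x y + h y^2 + 2 v y z + w z^2] as soon as [- N] is a
   square modulo [q] and [- 1 = q v^2] modulo [N]; such a form is equivalent to a sum of three
   squares by Hermite reduction, and then [N] is the squared norm of a cross product. Instead
   of a prime [q] supplied by Dirichlet's theorem, a product of primes [l] at which [- N] is a
   square is enough. By quadratic reciprocity these are the primes with [chi l = 1] for a real
   character [chi]; together with the squares they generate the kernel of [chi], since
   otherwise some real character [psi] other than [1] and [chi] would be [1] on all of them,
   and comparing two estimates of [sum psi(m) (sum_{d | m} chi(d)) / sqrt m] shows that this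
   is impossible. *)
Require Import Defs.
From Stdlib Require Import ZArith Lia Classical_Prop.
From mathcomp Require Import all_boot all_order all_algebra all_fingroup all_solvable finfield.
From mathcomp Require Import zify ring lra realalg.
Open Scope Z_scope.

(** * Unimodular ternary forms *)

Definition three_squares (n : Z) : Prop := exists x y z : Z, n = x ^ 2 + y ^ 2 + z ^ 2.

(** The symmetric matrix has diagonal [a], [b], [c] and off-diagonal entries [d] at (2,3), [e] at
    (1,3), [f] at (1,2). Being the Gram matrix of integer vectors means that its form is a sum of
    three squares of integral linear forms. *)
Definition gram (a b c d e f : Z) : Prop :=
  exists x1 x2 x3 y1 y2 y3 z1 z2 z3 : Z,
    a = x1 * x1 + x2 * x2 + x3 * x3 /\ b = y1 * y1 + y2 * y2 + y3 * y3 /\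
    c = z1 * z1 + z2 * z2 + z3 * z3 /\ d = y1 * z1 + y2 * z2 + y3 * z3 /\
    e = x1 * z1 + x2 * z2 + x3 * z3 /\ f = x1 * y1 + x2 * y2 + x3 * y3.

Lemma gram_swap12 (a b c d e f : Z) : gram b a c e d f -> gram a b c d e f.
Proof.
  intros (x1 & x2 & x3 & y1 & y2 & y3 & z1 & z2 & z3 & H).
  exists y1, y2, y3, x1, x2, x3, z1, z2, z3; lia.
Qed.

Lemma gram_swap23 (a b c d e f : Z) : gram a c b d f e -> gram a b c d e f.
Proof.
  intros (x1 & x2 & x3 & y1 & y2 & y3 & z1 & z2 & z3 & H).
  exists x1, x2, x3, z1, z2, z3, y1, y2, y3; lia.
Qed.

(** Base change adding [k] times the first vector to the second; it preserves the determinant. *)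
Lemma gram_shift12 (k a b c d e f : Z) :
  gram a (b + 2 * k * f + k * k * a) c (d + k * e) e (f + k * a) -> gram a b c d e f.
Proof.
  intros (x1 & x2 & x3 & y1 & y2 & y3 & z1 & z2 & z3 & Ha & Hb & Hc & Hd & He & Hf).
  exists x1, x2, x3, (y1 - k * x1), (y2 - k * x2), (y3 - k * x3), z1, z2, z3.
  assert (Hf' : f = x1 * (y1 - k * x1) + x2 * (y2 - k * x2) + x3 * (y3 - k * x3))
    by (rewrite Ha in Hf; lia).
  repeat split; auto.
  - rewrite Hf' Ha in Hb; lia.
  - rewrite He in Hd; lia.
Qed.

Lemma gram_shift23 (k a b c d e f : Z) :
  gram a b (c + 2 * k * d + k * k * b) (d + k * b) (e + k * f) f -> gram a b c d e f.
Proof.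
  intros (x1 & x2 & x3 & y1 & y2 & y3 & z1 & z2 & z3 & Ha & Hb & Hc & Hd & He & Hf).
  exists x1, x2, x3, y1, y2, y3, (z1 - k * y1), (z2 - k * y2), (z3 - k * y3).
  assert (Hd' : d = y1 * (z1 - k * y1) + y2 * (z2 - k * y2) + y3 * (z3 - k * y3))
    by (rewrite Hb in Hd; lia).
  repeat split; auto.
  - rewrite Hd' Hb in Hc; lia.
  - rewrite Hf in He; lia.
Qed.

Lemma centered_residue (m n : Z) : 0 < n -> exists k : Z, - n <= 2 * (m + k * n) <= n.
Proof.
  intros Hn; exists (- ((2 * m + n) / (2 * n))).
  pose proof (Z.div_mod (2 * m + n) (2 * n)); pose proof (Z.mod_pos_bound (2 * m + n) (2 * n)).
  nia.
Qed.

(** [A * C = a + D ^ 2] is positive and below [3/4 A ^ 2 + 1/4 A ^ 2]. In the reduction, [C] is the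
    leading minor after the last two variables are exchanged. *)
Lemma minor_step (a A C D : Z) : 0 < a -> 0 < A -> 4 * a < 3 * A * A -> - A <= 2 * D <= A ->
  A * C - D * D = a -> 0 < C < A.
Proof.
  intros Ha HA HaA HD H.
  assert (HDA : 0 <= (A - 2 * D) * (A + 2 * D)) by (apply Z.mul_nonneg_nonneg; lia).
  assert (0 <= D * D) by (apply Z.square_nonneg).
  split; apply (Z.mul_lt_mono_pos_l A); lia.
Qed.

(** From [a ^ 2 <= a * b = A + f ^ 2 <= A + a ^ 2 / 4] follows [3 * a ^ 2 <= 4 * A]; with
    [3 * A <= 3 * A ^ 2 <= 4 * a] this gives [9 * a ^ 2 <= 16 * a]. *)
Lemma reduced_coefficient (a A b f : Z) : 0 < a -> 0 < A -> 3 * A * A <= 4 * a ->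
  - a <= 2 * f <= a -> a * b - f * f = A -> a <= b -> a = 1.
Proof.
  intros Ha HA HAa Hf H Hb.
  assert (Hfa : 0 <= (a - 2 * f) * (a + 2 * f)) by (apply Z.mul_nonneg_nonneg; lia).
  assert (Hab : a * a <= a * b) by (apply Z.mul_le_mono_nonneg_l; lia).
  assert (HA2 : A * 1 <= A * A) by (apply Z.mul_le_mono_nonneg_l; lia).
  destruct (Z_lt_le_dec 1 a) as [Ha2 |]; [exfalso | lia].
  assert (2 * a <= a * a) by (apply Z.mul_le_mono_nonneg_r; lia).
  lia.
Qed.

(* Hermite reduction. The first coefficient and the leading minor [a * b - f * f] decrease
   lexicographically: once [|2 * f| <= a <= b], the bounds [3 * a ^ 2 <= 4 * (a * b - f * f)]
   and [3 * (a * b - f * f) ^ 2 <= 4 * a] force [a = 1]. *)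
Lemma gram_of_unimodular (a b c d e f : Z) :
  0 < a -> 0 < a * b - f * f ->
  a * b * c + 2 * d * e * f - a * d * d - b * e * e - c * f * f = 1 ->
  gram a b c d e f.
Proof.
  intros Ha; revert b c d e f.
  induction a as [a IHa] using (well_founded_induction (Z.lt_wf 0)).
  intros b c d e f HA; remember (a * b - f * f) as A eqn:EA.
  revert b c d e f EA.
  induction A as [A IHA] using (well_founded_induction (Z.lt_wf 0)).
  intros b c d e f EA Hdet.
  destruct (Z_lt_le_dec (4 * a) (3 * A * A)) as [HAa | HAa].
  - destruct (centered_residue (a * d - e * f) A HA) as [k Hk].
    apply (gram_shift23 k), gram_swap23.
    set (D := a * d - e * f + k * A) in Hk.
    set (C := a * (c + 2 * k * d + k * k * b) - (e + k * f) * (e + k * f)).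
    (* Jacobi's identity for minors: the left side is [a] times the determinant, which is 1. *)
    assert (HAC : A * C - D * D = a).
    { transitivity (a * (a * b * c + 2 * d * e * f - a * d * d - b * e * e - c * f * f));
        [unfold C, D; rewrite EA; ring | rewrite Hdet; ring]. }
    pose proof (minor_step a A C D Ha HA HAa Hk HAC) as HC.
    apply (IHA C); [lia | lia | reflexivity |].
    rewrite -Hdet; ring.
  - destruct (centered_residue f a Ha) as [k Hk].
    apply (gram_shift12 k).
    set (b' := b + 2 * k * f + k * k * a); set (f' := f + k * a) in *; set (d' := d + k * e).
    assert (HA' : a * b' - f' * f' = A) by (unfold b', f'; rewrite EA; ring).
    assert (Hdet' : a * b' * c + 2 * d' * e * f' - a * d' * d' - b' * e * e - c * f' * f' = 1)
      by (rewrite -Hdet; unfold b', f', d'; ring).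
    clearbody b' f' d'.
    destruct (Z_lt_le_dec b' a) as [Hb | Hb].
    + assert (0 < b') by (clear - Ha HA HA'; nia).
      apply gram_swap12; apply (IHa b'); [lia | lia | lia |].
      rewrite -Hdet'; ring.
    + assert (a = 1) by (apply (reduced_coefficient a A b' f'); assumption).
      subst a.
      assert (f' = 0) by lia; subst f'.
      assert (A = 1) by (clear - HA HAa; nia).
      assert (b' = 1) by lia; subst b'.
      (* With [a = b' = 1] and [f' = 0] the determinant condition reads [c = e ^ 2 + d' ^ 2 + 1]. *)
      exists 1, 0, 0, 0, 1, 0, e, d', 1; lia.
Qed.

Lemma three_squares_of_ternary (q b h v w : Z) :
  0 < q -> 0 < q * h - b * b -> w * (q * h - b * b) - q * v * v = 1 ->
  three_squares (q * h - b * b).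
Proof.
  intros Hq Hn Hdet.
  destruct (gram_of_unimodular q h w v 0 b) as
    (x1 & x2 & x3 & y1 & y2 & y3 & z1 & z2 & z3 & -> & -> & _ & _ & _ & ->); try lia.
  (* Lagrange's identity: the Gram determinant of two vectors is the squared norm of their cross
     product. *)
  exists (x2 * y3 - x3 * y2), (x3 * y1 - x1 * y3), (x1 * y2 - x2 * y1); ring.
Qed.

(** * The ternary form and sums of three squares *)

Definition ternary_rep (t : Z) : Prop := exists x z w : Z, t = x ^ 2 + 2 * (z ^ 2 + z * w + w ^ 2).

Lemma sign_mod_3 (X : Z) : exists k r : Z, X ^ 2 = (3 * k + r) ^ 2 /\ (r = 0 \/ r = 1).
Proof.
  assert (HX : X = 3 * (X / 3) \/ X = 3 * (X / 3) + 1 \/ X = 3 * (X / 3) + 2)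
    by (Z.div_mod_to_equations; lia).
  destruct HX as [HX | [HX | HX]]; [exists (X / 3), 0 | exists (X / 3), 1 | exists (- X / 3), 1];
    (split; [| lia]).
  - rewrite {1}HX; ring.
  - rewrite {1}HX; ring.
  - replace (3 * (- X / 3) + 1) with (- X) by (Z.div_mod_to_equations; lia); ring.
Qed.

(* Up to signs the three squares are those of [A], [B], [C] congruent modulo [3]. With
   [x = (A + B + C) / 3], the sum of squares is [3 x ^ 2 + 2 (p ^ 2 + p q + q ^ 2)] for
   [p = A - x] and [q = B - x], and [p - q] is divisible by [3]. *)
Lemma ternary_rep_of_three_squares (t : Z) : three_squares (3 * t) -> ternary_rep t.
Proof.
  intros (A & B & C & H).
  destruct (sign_mod_3 A) as (k & r & EA & Hr), (sign_mod_3 B) as (l & r' & EB & Hr'),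
    (sign_mod_3 C) as (m & r'' & EC & Hr'').
  rewrite EA EB EC in H.
  (* Squares are 0 or 1 modulo 3, so three of them have a sum divisible by 3 only if all residues
     agree. *)
  assert (r' = r /\ r'' = r) as [-> ->]
    by (destruct Hr as [-> | ->], Hr' as [-> | ->], Hr'' as [-> | ->]; lia).
  set (x := k + l + m + r); set (q := 3 * l + r - x).
  exists x, (q + (k - l)), (k - l).
  apply (Z.mul_reg_l _ _ 3); [lia |]; rewrite H; unfold q, x; ring.
Qed.

Lemma represents_sub (b n y : Z) : ternary_rep (n - b * y ^ 2) -> represents 1 b n.
Proof. intros (x & z & w & H); exists x, y, z, w; unfold f2; lia. Qed.

(** * Restrictions on the coefficients *)

Lemma norm_form_nonneg (z w : Z) : 0 <= z ^ 2 + z * w + w ^ 2.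
Proof. pose proof (Z.square_nonneg (2 * z + w)); pose proof (Z.square_nonneg w); lia. Qed.

(** An even value forces [z] and [w] to be even, and is then a multiple of 4. *)
Lemma norm_form_ne_2 (z w : Z) : z ^ 2 + z * w + w ^ 2 <> 2.
Proof.
  intros H.
  assert (Hz : z = 2 * (z / 2) \/ z = 2 * (z / 2) + 1) by (Z.div_mod_to_equations; lia).
  assert (Hw : w = 2 * (w / 2) \/ w = 2 * (w / 2) + 1) by (Z.div_mod_to_equations; lia).
  destruct Hz as [Hz | Hz], Hw as [Hw | Hw]; rewrite Hz Hw in H; lia.
Qed.

Lemma sq_eq_0_or_pos (v : Z) : v = 0 \/ 1 <= v ^ 2.
Proof. destruct (Z.eq_dec v 0); [auto | right; nia]. Qed.

Lemma sq_le_5 (v : Z) : v ^ 2 <= 5 -> v = -2 \/ v = -1 \/ v = 0 \/ v = 1 \/ v = 2.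
Proof. intros H; assert (-2 <= v <= 2) by nia; lia. Qed.

Lemma mul_sq_eq_0_or_ge (c v : Z) : 0 < c -> 0 <= c * v ^ 2 /\ (v = 0 \/ c <= c * v ^ 2).
Proof.
  intros Hc; destruct (sq_eq_0_or_pos v) as [-> | Hv]; [rewrite Z.mul_0_r; lia |].
  assert (c * 1 <= c * v ^ 2) by (apply Z.mul_le_mono_nonneg_l; lia); lia.
Qed.

(** If [a >= 2], every nonzero value is at least 2. If [a = 1] and [b > 5], a representation of 5
    has [y' = 0]; by parity [x' ^ 2 = 1], and the norm form would have to take the value 2. *)
Lemma coefficients_bound (a b : Z) : 0 < a -> a <= b -> represents a b 1 -> represents a b 5 ->
  a = 1 /\ 1 <= b <= 5.
Proof.
  intros Ha Hab; assert (Hb : 0 < b) by lia; unfold represents, f2.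
  intros (x & y & z & w & H1) (x' & y' & z' & w' & H5).
  assert (a = 1).
  { clear H5; pose proof (norm_form_nonneg z w) as Hzw.
    destruct (mul_sq_eq_0_or_ge a x Ha) as [Hx0 Hx], (mul_sq_eq_0_or_ge b y Hb) as [Hy0 Hy].
    generalize dependent (z ^ 2 + z * w + w ^ 2); intros q H1 Hq.
    destruct Hx as [-> | Hx]; [destruct Hy as [-> | Hy]; [lia |] |].
    - generalize dependent (b * y ^ 2); lia.
    - generalize dependent (a * x ^ 2); generalize dependent (b * y ^ 2); lia. }
  subst a; split; [reflexivity |]; clear H1.
  pose proof (norm_form_nonneg z' w') as Hzw; pose proof (norm_form_ne_2 z' w') as H2.
  generalize dependent (z' ^ 2 + z' * w' + w' ^ 2); intros q H5 Hq H2.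
  destruct (mul_sq_eq_0_or_ge b y' Hb) as [Hy0 [-> | Hy]].
  - rewrite Z.mul_1_l in H5.
    destruct (sq_le_5 x') as [-> | [-> | [-> | [-> | ->]]]]; lia.
  - pose proof (proj1 (mul_sq_eq_0_or_ge 1 x' Ha)) as Hx0.
    revert Hx0 Hy0 Hy H5; generalize (1 * x' ^ 2) (b * y' ^ 2); lia.
Qed.

(** These are the residues for which [3 * t] is 1 or 2 modulo 4, or 3 modulo 8. *)
Definition ternary_good (t : Z) : Prop :=
  t mod 8 = 1 \/ t mod 8 = 2 \/ t mod 8 = 3 \/ t mod 8 = 6 \/ t mod 8 = 7.


Set Implicit Arguments. Unset Strict Implicit. Unset Printing Implicit Defensive.
Import Order.TTheory GRing.Theory Num.Theory GroupScope.
Local Open Scope ring_scope.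

(** * Real characters and the hyperbola method *)

(** Two factors above [y] have a product above [y ^ 2], so the region under the hyperbola is a
    square together with two disjoint tails. *)
Lemma sum_hyperbola (V : zmodType) (F : nat -> nat -> V) (y : nat) :
  \sum_(1 <= d < (y ^ 2).+1) \sum_(1 <= e < (y ^ 2).+1 | (d * e <= y ^ 2)%N) F d e =
    \sum_(1 <= d < y.+1) \sum_(1 <= e < y.+1) F d e +
    \sum_(1 <= d < y.+1) \sum_(y.+1 <= e < (y ^ 2 %/ d).+1) F d e +
    \sum_(1 <= e < y.+1) \sum_(y.+1 <= d < (y ^ 2 %/ e).+1) F d e.
Proof.
have yX : (y <= y ^ 2)%N by case: y => // y; rewrite leq_pmulr.
have widen d (f : nat -> V) : (0 < d)%N ->
    \sum_(y.+1 <= e < (y ^ 2).+1 | (d * e <= y ^ 2)%N) f e =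
    \sum_(y.+1 <= e < (y ^ 2 %/ d).+1) f e.
  move=> d0; rewrite [RHS](big_nat_widen _ _ (y ^ 2).+1) ?ltnS ?leq_div //.
  by apply: eq_bigl => e; rewrite ltnS leq_divRL // mulnC.
rewrite (big_cat_nat (n := y.+1)) //= -big_split /=; congr (_ + _).
  rewrite !big_nat; apply: eq_bigr => d /andP[d0 dy].
  rewrite (big_cat_nat (n := y.+1)) //= widen //; congr (_ + _).
  rewrite [RHS]big_nat [LHS]big_nat_cond; apply: eq_bigl => e.
  by apply: andb_idr => /andP[_ ey]; rewrite -mulnn leq_mul.
rewrite (exchange_big_dep xpredT) //= (big_cat_nat (n := y.+1)) //= [X in _ + X]big1_seq ?addr0.
  by rewrite !big_nat; apply: eq_bigr => e /andP[e0 _]; under eq_bigl do rewrite mulnC;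
    exact: widen.
move=> e; rewrite mem_index_iota => /andP[_ /andP[ye _]].
rewrite big_nat_cond big_pred0 // => d; apply/negbTE/negP => /andP[/andP[yd _]].
by apply/negP; rewrite -ltnNge -mulnn ltn_mul.
Qed.

Section Hyperbola.
Variable R : rcfType.
Implicit Types (a b w : nat -> R) (B : R).

(** Summation by parts: since the weights decrease, their differences are nonnegative and
    telescope. *)
Lemma abel_bound a w B s t :
    (forall t, `|\sum_(s <= d < t) a d| <= B) -> 
    (forall d, (s <= d)%N -> w d.+1 <= w d) -> (forall d, 0 <= w d) ->
  `|\sum_(s <= d < t) a d * w d| <= B * w s.
Proof.
move=> aB wS w0.
have B0 : 0 <= B by rewrite (le_trans _ (aB s)).
have [ts|] := leqP t s; first by rewrite big_geq // normr0 mulr_ge0.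
case: t => // t st; set P := fun t => \sum_(s <= d < t) a d.
(* Removing the boundary term leaves a statement that passes through induction on [t]. *)
suff H : `|\sum_(s <= d < t.+1) a d * w d - P t.+1 * w t| <= B * (w s - w t).
  have -> : \sum_(s <= d < t.+1) a d * w d =
    (\sum_(s <= d < t.+1) a d * w d - P t.+1 * w t) + P t.+1 * w t by rewrite subrK.
  rewrite (le_trans (ler_normD _ _)) //.
  have -> : B * w s = B * (w s - w t) + B * w t by ring.
  apply: lerD => //; rewrite normrM (ger0_norm (w0 t)).
  by apply: ler_wpM2r => //; apply: aB.
move: st; rewrite ltnS; elim: t => [|t IH] st.
  by move: st; rewrite leqn0 => /eqP s0; rewrite /P s0 !big_nat1 !subrr normr0 mulr0.
move: st; rewrite leq_eqVlt => /orP[/eqP s1|st].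
  by rewrite /P s1 !big_nat1 !subrr normr0 mulr0.
have PS : P t.+2 = P t.+1 + a t.+1 by rewrite /P big_nat_recr //= ltnW.
rewrite big_nat_recr ?(ltnW st) //= PS.
have -> : \sum_(s <= i < t.+1) a i * w i + a t.+1 * w t.+1 -
   (P t.+1 + a t.+1) * w t.+1 =
   (\sum_(s <= i < t.+1) a i * w i - P t.+1 * w t) + P t.+1 * (w t - w t.+1) by ring.
have -> : B * (w s - w t.+1) = B * (w s - w t) + B * (w t - w t.+1) by ring.
rewrite (le_trans (ler_normD _ _)) // lerD ?IH // normrM ler_pM //; first exact: aB.
by rewrite ger0_norm // subr_ge0 wS.
Qed.

(** At 0 the value is 0, which makes [rsqrtM] hold for all arguments. *)
Definition rsqrt (n : nat) : R := (Num.sqrt n%:R)^-1.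

Lemma rsqrt_ge0 n : 0 <= rsqrt n. Proof. by rewrite invr_ge0 sqrtr_ge0. Qed.

Lemma rsqrtM m n : rsqrt (m * n) = rsqrt m * rsqrt n.
Proof. by rewrite /rsqrt natrM sqrtrM ?ler0n // invfM. Qed.

Lemma rsqrt_le m n : (0 < m <= n)%N -> rsqrt n <= rsqrt m.
Proof.
case/andP=> m0 mn; rewrite lef_pV2 ?posrE ?sqrtr_gt0 ?ltr0n //; last exact: leq_trans mn.
by rewrite ler_sqrt ?ler_nat // ler0n.
Qed.

Lemma rsqrt_sqr n : rsqrt (n ^ 2) = n%:R^-1.
Proof. by rewrite /rsqrt natrX sqrtr_sqr ger0_norm. Qed.

(** Each step needs [1 / sqrt (n + 1) <= 2 (sqrt (n + 1) - sqrt n)], which amounts to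
    [(sqrt (n + 1) - sqrt n) ^ 2 >= 0]. *)
Lemma sum_rsqrt_le n : \sum_(1 <= d < n.+1) rsqrt d <= 2 * Num.sqrt n%:R.
Proof.
elim: n => [|n IH]; first by rewrite big_geq // mulr_ge0 ?sqrtr_ge0.
rewrite big_nat_recr //= (le_trans (lerD IH (lexx _))) //.
have h0 : 0 <= (n%:R : R) by [].
have E1 := sqr_sqrtr h0.
have E2 : Num.sqrt n.+1%:R ^+ 2 = n.+1%:R :> R by rewrite sqr_sqrtr.
have p2 : 0 < Num.sqrt n.+1%:R :> R by rewrite sqrtr_gt0 ltr0n.
have p1 := sqrtr_ge0 (n%:R : R).
rewrite /rsqrt -(ler_pM2r p2) mulrDl mulVf ?gt_eqF //.
have E3 : Num.sqrt n.+1%:R ^+ 2 = Num.sqrt n%:R ^+ 2 + 1 :> R by rewrite E2 -natr1 E1.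
by have := sqr_ge0 (Num.sqrt n%:R - Num.sqrt n.+1%:R : R); nra.
Qed.

(** The bound does not depend on [y]. The square contributes at most [B * B]. In each tail the inner
    sum is at most [B / sqrt Y] by summation by parts, and the outer weights add up to at most
    [2 * sqrt Y]. *)
Lemma hyperbola_bound a b B y :
    (forall s t, `|\sum_(s <= d < t) a d| <= B) ->
    (forall s t, `|\sum_(s <= d < t) b d| <= B) ->
    (forall d, `|a d| <= 1) -> (forall d, `|b d| <= 1) ->
  `|\sum_(1 <= d < (y ^ 2).+1) \sum_(1 <= e < (y ^ 2).+1 | (d * e <= y ^ 2)%N)
     a d * b e * rsqrt (d * e)| <= B ^+ 2 + 4 * B.
Proof.
move=> aB bB a1 b1; set X := (y ^ 2)%N.
case: y @X => [|y] X.
  rewrite big_geq // normr0; have B0 := le_trans (normr_ge0 _) (aB 0 0)%N.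
  by rewrite addr_ge0 ?sqr_ge0 ?mulr_ge0.
have B0 : 0 <= B := le_trans (normr_ge0 _) (aB 0 0)%N.
set Y := y.+1 in X *; have YX : (Y <= X)%N by rewrite /X leq_pmulr.
pose F d e := a d * b e * rsqrt (d * e).
rewrite -/X (sum_hyperbola F).
have outer c c' : (forall d, `|c d| <= 1) ->
    (forall s t, `|\sum_(s <= d < t) c' d| <= B) ->
   `|\sum_(1 <= d < Y.+1) c d * rsqrt d *
       \sum_(Y.+1 <= e < (X %/ d).+1) c' e * rsqrt e| <= 2 * B.
  move=> c1 c'B; apply: le_trans (ler_norm_sum _ _ _) _.
  have -> : 2 * B = 2 * Num.sqrt Y%:R * (B * rsqrt Y).
    have : Num.sqrt Y%:R != 0 :> R by rewrite gt_eqF // sqrtr_gt0 ltr0n.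
    by rewrite /rsqrt => ?; field.
  apply: le_trans (ler_wpM2r _ (sum_rsqrt_le Y)); last by rewrite mulr_ge0 ?rsqrt_ge0.
  rewrite big_distrl /=; apply: ler_sum => i _.
  rewrite !normrM (ger0_norm (rsqrt_ge0 i)) ler_pM ?mulr_ge0 ?rsqrt_ge0 //.
    by rewrite ler_piMl ?rsqrt_ge0.
  apply: le_trans (abel_bound _ (c'B Y.+1) _ rsqrt_ge0) _.
    by move=> e Ye; apply: rsqrt_le; rewrite leqnSn andbT (leq_trans _ Ye).
  by rewrite ler_wpM2l // rsqrt_le // leqnSn andbT.
have inner c : (forall s t, `|\sum_(s <= d < t) c d| <= B) ->
    `|\sum_(1 <= d < Y.+1) c d * rsqrt d| <= B.
  move=> cB; apply: le_trans (abel_bound _ (cB 1)%N _ rsqrt_ge0) _.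
    by move=> e e0; apply: rsqrt_le; rewrite leqnSn andbT.
  by rewrite /rsqrt sqrtr1 invr1 mulr1.
have -> : B ^+ 2 + 4 * B = B ^+ 2 + 2 * B + 2 * B by ring.
apply: le_trans (ler_normD _ _) (lerD (le_trans (ler_normD _ _) (lerD _ _)) _).
- rewrite (_ : \sum_(1 <= d < _) _ = (\sum_(1 <= d < Y.+1) a d * rsqrt d) *
      (\sum_(1 <= e < Y.+1) b e * rsqrt e)).
    by rewrite normrM expr2 ler_pM ?inner.
  rewrite big_distrlr /=; apply: eq_bigr => d _; apply: eq_bigr => e _.
  by rewrite /F rsqrtM mulrACA.
- rewrite (eq_bigr (fun d => a d * rsqrt d *
      \sum_(Y.+1 <= e < (X %/ d).+1) b e * rsqrt e)); first exact: outer.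
  by move=> d _; rewrite big_distrr /=; apply: eq_bigr => e _; rewrite /F rsqrtM mulrACA.
- rewrite (eq_bigr (fun e => b e * rsqrt e *
      \sum_(Y.+1 <= d < (X %/ e).+1) a d * rsqrt d)); first exact: outer.
  move=> e _; rewrite big_distrr /=; apply: eq_bigr => d _.
  by rewrite /F rsqrtM mulrACA mulrC.
Qed.
End Hyperbola.

Lemma pfactor_ind (P : nat -> Prop) : P 1%N ->
    (forall p k m, prime p -> (0 < m)%N -> ~~ (p %| m)%N -> P m -> P (p ^ k * m)%N) ->
  forall m, (0 < m)%N -> P m.
Proof.
move=> P1 PS; elim/ltn_ind => m IH m0.
have [m1|m1] := leqP m 1; first by have -> : m = 1%N by lia.
have pp := pdiv_prime m1; have [m' cop Em] := pfactor_coprime pp m0.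
have m'0 : (0 < m')%N by move: m0; rewrite Em muln_gt0 => /andP[].
rewrite Em mulnC; apply: PS => //; first by rewrite -prime_coprime.
apply: IH => //; rewrite [X in (_ < X)%N]Em ltn_Pmulr //.
rewrite -(exp1n (logn (pdiv m) m)) ltn_exp2r ?prime_gt1 //.
by rewrite logn_gt0 mem_primes pp m0 pdiv_dvd.
Qed.

(** Real Dirichlet characters modulo [M]. Integer values can be mapped both to a real closed field,
    for the estimates, and to ['F_p], for Euler's criterion. *)
Record rchar (M : nat) (chi : nat -> int) : Prop := RChar {
  rcharM : forall m n, chi (m * n)%N = chi m * chi n;
  rcharD : forall m, chi (m + M)%N = chi m;
  rchar_sqr : forall m, coprime m M -> chi m ^+ 2 = 1;
  rchar0 : forall m, ~~ coprime m M -> chi m = 0 }.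

Section RealCharacter.
Variables (M : nat) (chi : nat -> int).
Hypotheses (M0 : (0 < M)%N) (chiP : rchar M chi).

Lemma rchar_cases m : [\/ chi m = 1, chi m = 0 | chi m = -1].
Proof.
have [/(rchar_sqr chiP)/eqP|/(rchar0 chiP)->] := boolP (coprime m M); last by constructor 2.
by rewrite sqrf_eq1 => /orP[]/eqP ->; [constructor 1|constructor 3].
Qed.

Lemma rchar_norm m : `|chi m| <= 1.
Proof. by case: (rchar_cases m) => ->. Qed.

Lemma rchar1 : chi 1 = 1.
Proof.
have := rcharM chiP 1 1; have := rchar_sqr chiP (coprime1n M); rewrite mul1n.
by case: (rchar_cases 1) => ->.
Qed.

Lemma rcharX m k : chi (m ^ k)%N = chi m ^+ k.
Proof. by elim: k => [|k IH]; rewrite ?expn0 ?rchar1 // expnS (rcharM chiP) IH exprS. Qed.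

Lemma rcharMD j m : chi (j * M + m)%N = chi m.
Proof. by elim: j => [|j IH] //; rewrite mulSn -addnA addnC (rcharD chiP). Qed.

Lemma rchar_mod m : chi (m %% M)%N = chi m.
Proof. by rewrite [in RHS](divn_eq m M) rcharMD. Qed.

Hypothesis nonprincipal : exists c, chi c = -1.

(** Multiplication by [c] permutes the residues and changes the sign of the sum. *)
Lemma rchar_sum_period : \sum_(0 <= d < M) chi d = 0.
Proof.
have [c chic] := nonprincipal.
have cop : coprime c M by apply/negPn/negP => /(rchar0 chiP); rewrite chic.
pose f (i : 'I_M) := Ordinal (ltn_pmod (c * i) M0).
have f_inj : injective f.
  move=> i j /(congr1 val) /= /eqP; wlog ij : i j / (i <= j)%N.
    by move=> H e; case: (leqP i j) => [|/ltnW] ij; [exact: H|apply/esym/H; rewrite // eq_sym].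
  rewrite eq_sym eqn_mod_dvd ?leq_mul // -mulnBr Gauss_dvdr 1?coprime_sym //.
  move=> dv; apply/val_inj/eqP; rewrite eqn_leq ij -subn_eq0 /=.
  apply: contraLR dv; rewrite -lt0n => ?; rewrite gtnNdvd //.
  by rewrite (leq_ltn_trans (leq_subr _ _)).
rewrite big_mkord; suff : \sum_(i < M) chi i = - \sum_(i < M) chi i.
  by move: (\sum_(i < M) chi i) => S; lia.
rewrite {1}(reindex_inj f_inj) -sumrN; apply: eq_bigr => i _ /=.
by rewrite rchar_mod (rcharM chiP) chic mulN1r.
Qed.

(** Windows of length [M] sum to 0; fewer than [M] terms, each of absolute value at most 1,
    remain. *)
Lemma rchar_sum_bound s t : `|\sum_(s <= d < t) chi d| <= M%:R.
Proof.
have window u : \sum_(u <= d < u + M) chi d = 0.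
  elim: u => [|u IH]; first exact: rchar_sum_period.
  have : \sum_(u <= d < (u + M).+1) chi d = chi u.
    by rewrite big_nat_recr ?leq_addr //= IH add0r (rcharD chiP).
  by rewrite big_ltn ?ltnS ?leq_addr // addSn -[RHS]addr0 => /addrI.
have [ts|/ltnW/subnKC <-] := leqP t s; first by rewrite big_geq // normr0.
move: (t - s)%N => n; elim/ltn_ind: n s => n IH s; have [nM|Mn] := ltnP n M.
  apply: le_trans (ler_norm_sum _ _ _) _; apply: (@le_trans _ _ (\sum_(s <= d < s + n) 1)).
    by apply: ler_sum => d _; exact: rchar_norm.
  by rewrite sumr_const_nat addKn ler_nat ltnW.
rewrite (big_cat_nat (n := s + M)) ?leq_addr ?leq_add2l //= window add0r.
by rewrite -(subnKC Mn) addnA; apply: IH; lia.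
Qed.
End RealCharacter.

(** * Divisor sums of a real character *)

Section DivisorSum.
Variables (M : nat) (chi : nat -> int).
Hypotheses (M0 : (0 < M)%N) (chiP : rchar M chi).

Definition divsum (m : nat) : int := \sum_(d <- divisors m) chi d.

(** The new divisors are exactly [p ^ k.+1] times the divisors of [m]. *)
Lemma divsum_pfactorS p k m : prime p -> (0 < m)%N -> ~~ (p %| m)%N ->
  divsum (p ^ k.+1 * m) = divsum (p ^ k * m) + chi p ^+ k.+1 * divsum m.
Proof.
move=> pp m0 pm; have p0 := prime_gt0 pp.
have pk0 i : (0 < p ^ i)%N by rewrite expn_gt0 p0.
rewrite /divsum (perm_big (divisors (p ^ k * m) ++ map (muln (p ^ k.+1)) (divisors m))) /=.
  rewrite big_cat big_map mulr_sumr; congr (_ + _); apply: eq_bigr => d _.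
  by rewrite (rcharM chiP) (rcharX chiP).
apply: uniq_perm; first exact: divisors_uniq.
  rewrite cat_uniq divisors_uniq map_inj_uniq ?divisors_uniq ?andbT //=; last first.
    by move=> d e /eqP; rewrite eqn_pmul2l // => /eqP.
  apply/hasPn => _ /mapP[d _ ->]; rewrite -dvdn_divisors ?muln_gt0 ?pk0 //.
  apply: contra pm => dv; rewrite -(dvdn_pmul2l (pk0 k)) -expnSr.
  exact: dvdn_trans (dvdn_mulr _ (dvdnn _)) dv.
move=> d; rewrite mem_cat -!dvdn_divisors ?muln_gt0 ?pk0 //.
apply/idP/orP => [dv|[dv|/mapP[e]]]; last 2 first.
- by apply: dvdn_trans dv _; rewrite expnS -mulnA dvdn_mull.
- by rewrite -dvdn_divisors // => em ->; rewrite dvdn_pmul2l.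
have [pd|pd] := boolP (p ^ k.+1 %| d)%N.
  right; case/dvdnP: pd dv => e ->; rewrite mulnC dvdn_pmul2l // => em.
  by apply/mapP; exists e; rewrite // -dvdn_divisors.
left; have d0 : (0 < d)%N by apply: dvdn_gt0 dv; rewrite muln_gt0 pk0.
have [d' cop Ed] := pfactor_coprime pp d0.
have dk : (logn p d <= k)%N by rewrite leqNgt -pfactor_dvdn.
rewrite Ed mulnC dvdn_mul ?dvdn_exp2l //.
rewrite -(@Gauss_dvdr _ (p ^ k.+1)) ?coprimeXr 1?coprime_sym //.
by apply: dvdn_trans dv; rewrite Ed dvdn_mulr.
Qed.

Lemma divsum_pfactor p k m : prime p -> (0 < m)%N -> ~~ (p %| m)%N ->
  divsum (p ^ k * m) = (\sum_(i < k.+1) chi p ^+ i) * divsum m.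
Proof.
move=> pp m0 pm; elim: k => [|k IH]; first by rewrite mul1n big_ord1 mul1r.
by rewrite divsum_pfactorS // IH [in RHS]big_ord_recr /= mulrDl.
Qed.

Lemma geometric_sign (k : nat) : \sum_(i < k.+1) (-1) ^+ i = (~~ odd k)%:R :> int.
Proof.
elim: k => [|k IH]; first by rewrite big_ord1.
by rewrite big_ord_recr IH /= -signr_odd /=; case: odd.
Qed.

Lemma divsum1 : divsum 1 = 1.
Proof. by rewrite /divsum big_seq1 (rchar1 chiP). Qed.

Lemma geometric_rchar_ge0 p k : 0 <= \sum_(i < k.+1) chi p ^+ i.
Proof.
case: (rchar_cases chiP p) => ->; last by rewrite geometric_sign ler0n.
all: by apply: sumr_ge0 => i _; apply: exprn_ge0.
Qed.

Lemma divsum_ge0 m : (0 < m)%N -> 0 <= divsum m.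
Proof.
move: m; apply: pfactor_ind => [|p k m pp m0 pm IH]; first by rewrite divsum1.
by rewrite divsum_pfactor // mulr_ge0 // geometric_rchar_ge0.
Qed.

(** All exponents are even, so each local factor has an odd number of terms: it equals 1 when
    [chi p = -1], and otherwise its terms are nonnegative with first term 1. *)
Lemma divsum_sqr_ge1 m : (0 < m)%N -> 1 <= divsum (m ^ 2).
Proof.
move: m; apply: pfactor_ind => [|p k m pp m0 pm IH]; first by rewrite divsum1.
rewrite expnMn -expnM divsum_pfactor ?expn_gt0 ?m0 // ?Euclid_dvdX //; last by rewrite (negPf pm).
rewrite -[1]mulr1 ler_pM //; case: (rchar_cases chiP p) => ->.
- by rewrite big_ord_recl expr0 lerDl; apply: sumr_ge0 => i _; apply: exprn_ge0.
- by rewrite big_ord_recl expr0 lerDl; apply: sumr_ge0 => i _; apply: exprn_ge0.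
- by rewrite geometric_sign muln2 odd_double.
Qed.

(** A prime with [chi p = -1] must occur to an even power, on which [psi] is 1; primes with
    [chi p = 1] are covered by the hypothesis, and those with [chi p = 0] do not divide [m]. *)
Lemma divsum_support psi m : rchar M psi ->
    (forall p, prime p -> chi p = 1 -> psi p = 1) ->
  (0 < m)%N -> coprime m M -> divsum m != 0 -> psi m = 1.
Proof.
move=> psiP H; move: m; apply: pfactor_ind => [|p k m pp m0 pm IH]; first by rewrite (rchar1 psiP).
rewrite coprimeMl divsum_pfactor // mulf_eq0 negb_or => /andP[cpk cm] /andP[gk /IH -/(_ cm) Em].
rewrite (rcharM psiP) Em mulr1 (rcharX psiP).
case: k cpk gk => [|k]; first by rewrite expr0.
rewrite coprime_pexpl // => cp; case: (rchar_cases chiP p) => [/H ->|chi0|->]; rewrite ?expr1n //.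
  by have := rchar_sqr chiP cp; rewrite chi0.
rewrite geometric_sign pnatr_eq0 eqb0 negbK => /even_halfK <-.
by rewrite -mul2n exprM (rchar_sqr psiP cp) expr1n.
Qed.
End DivisorSum.

Lemma sum_hyperbola_divisors (V : zmodType) (G : nat -> nat -> V) (X : nat) :
  \sum_(1 <= d < X.+1) \sum_(1 <= e < X.+1 | (d * e <= X)%N) G d (d * e)%N =
  \sum_(1 <= m < X.+1) \sum_(d <- divisors m) G d m.
Proof.
have reindex d : (0 < d)%N ->
    \sum_(1 <= e < X.+1 | (d * e <= X)%N) G d (d * e)%N =
    \sum_(1 <= m < X.+1 | (d %| m)%N) G d m.
  move=> d0; under [RHS]eq_bigl do rewrite -[(d %| _)%N]andbT.
  transitivity (\sum_(1 <= e < X.+1) \sum_(1 <= m < X.+1 | m == (d * e)%N) G d m).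
    rewrite big_nat_cond [RHS]big_nat big_mkcondr /=; apply: eq_bigr => e /andP[e0 _].
    by rewrite big_nat1_eq muln_gt0 d0 e0 ltnS.
  rewrite (exchange_big_dep (fun m => (d %| m)%N)) /=; last first.
    by move=> e m _ /eqP ->; rewrite dvdn_mulr.
  rewrite [LHS]big_nat_cond [RHS]big_nat_cond; under [RHS]eq_bigl do rewrite andbT.
  apply: eq_bigr => m /andP[/andP[m0 mX] /dvdnP[q Em]].
  have eq_q e : (m == d * e)%N = (e == q) by rewrite Em mulnC eqn_pmul2l // eq_sym.
  under eq_bigl do rewrite eq_q.
  rewrite big_nat1_eq ifT // ltnS.
  move: m0 mX; rewrite Em muln_gt0 => /andP[-> _]; rewrite ltnS => /= h.
  by apply: leq_trans h; rewrite leq_pmulr.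
rewrite big_nat; under eq_bigr => d /andP[d0 _] do rewrite reindex //.
rewrite -big_nat (exchange_big_dep xpredT) //=.
rewrite !big_nat; apply: eq_bigr => m /andP[m0 mX].
rewrite -big_filter; apply: perm_big; apply: uniq_perm.
- by rewrite filter_uniq // iota_uniq.
- exact: divisors_uniq.
move=> d; rewrite mem_filter mem_index_iota -dvdn_divisors // andb_idr // => dm.
by rewrite (dvdn_gt0 m0 dm) (leq_ltn_trans (dvdn_leq m0 dm)).
Qed.

Lemma ler_sum_subseq (R : numDomainType) (I : eqType) (r s : seq I) (F : I -> R) :
  uniq r -> uniq s -> {subset s <= r} -> (forall i, i \in r -> 0 <= F i) ->
  \sum_(i <- s) F i <= \sum_(i <- r) F i.
Proof.
move=> ur us sr F0; have -> : \sum_(i <- s) F i = \sum_(i <- r | i \in s) F i.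
  rewrite -[RHS]big_filter; apply: perm_big; apply: uniq_perm => //; first exact: filter_uniq.
  by move=> i; rewrite mem_filter andb_idr // => /sr.
rewrite [leRHS](bigID (mem s)) /= lerDl big_seq_cond; apply: sumr_ge0 => i /andP[ir _].
exact: F0.
Qed.

(** Each dyadic block has [2 ^ n] terms, all at least [1 / 2 ^ n.+1], and so contributes at least
    one half. *)
Lemma harmonic_ge (R : numFieldType) (n : nat) :
  n%:R / 2 <= \sum_(0 <= j < 2 ^ n) (j.+1%:R : R)^-1.
Proof.
elim: n => [|n IH]; first by rewrite mul0r big_nat1 invr1.
rewrite (big_cat_nat (n := 2 ^ n)) ?leq_exp2l //= -natr1 mulrDl lerD //.
have -> : 1 / 2 = \sum_(2 ^ n <= j < 2 ^ n.+1) ((2 ^ n.+1)%:R : R)^-1.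
  rewrite sumr_const_nat expnS mul2n -addnn addnK natrD -mulr_natr -mulr2n.
  have : (2 ^ n)%:R != 0 :> R by rewrite pnatr_eq0 expn_eq0.
  by move=> ?; field.
rewrite !big_nat; apply: ler_sum => j /andP[_ j2].
by rewrite lef_pV2 ?posrE ?ltr0n ?expn_gt0 // ler_nat.
Qed.

(* If [chi p = 1] forced [psi p = 1], then [psi * divsum chi], the Dirichlet convolution of
   [psi] and [psi * chi], would be nonnegative and at least [1] at squares of numbers
   congruent to [1], so that its sum weighted by [1 / sqrt m] would diverge. But the
   hyperbola method bounds this sum. *)
Lemma exists_prime_separating (M : nat) (chi psi : nat -> int) : (0 < M)%N ->
    rchar M chi -> rchar M psi ->
    (exists c, psi c = -1) -> (exists c, chi c * psi c = -1) ->
  exists p, [/\ prime p, chi p = 1 & psi p = -1].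
Proof.
move=> M0 chiP psiP psi_np cp_np; apply: NNPP => none.
have psi1 p : prime p -> chi p = 1 -> psi p = 1.
  move=> pp chi1; case: (rchar_cases psiP p) => // e; last by case: none; exists p.
  have : coprime p M by apply/negPn/negP => /(rchar0 chiP); rewrite chi1.
  by move/(rchar_sqr psiP); rewrite e.
have cpP : rchar M (fun m => chi m * psi m).
  split=> [m n|m|m cop|m cop].
  - by rewrite (rcharM chiP) (rcharM psiP) mulrACA.
  - by rewrite (rcharD chiP) (rcharD psiP).
  - by rewrite exprMn (rchar_sqr chiP) // (rchar_sqr psiP).
  - by rewrite (rchar0 chiP) // mul0r.
have [R _] : exists R : rcfType, True by exists realalg.
have bnd f : rchar M f -> (exists c, f c = -1) ->
    forall s t, `|\sum_(s <= d < t) ((f d)%:~R : R)| <= M%:R.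
  move=> fP fnp s t; rewrite -rmorph_sum /= -intr_norm -[M%:R]/((M%:Z)%:~R) ler_int.
  by apply: le_trans (rchar_sum_bound M0 fP fnp s t) _; rewrite natz.
have nrm f : rchar M f -> forall d, `|((f d)%:~R : R)| <= 1.
  by move=> fP d; rewrite -intr_norm -[1]/(1%:~R) ler_int; exact: rchar_norm fP d.
have := hyperbola_bound _ (bnd _ cpP cp_np) (bnd _ psiP psi_np) (nrm _ cpP) (nrm _ psiP).
set C := M%:R ^+ 2 + 4 * M%:R => hyp.
(* The squares will contribute at least [n / (2 * M)]; this [n] makes that exceed [C]. *)
pose n := (2 * M * (M ^ 2 + 4 * M)).+1; pose J := (2 ^ n)%N.
(* With this cutoff the squares of [1 + j * M] for [j < J] all lie in the range of summation. *)
have := hyp (J * M)%N; apply/negP; rewrite -ltNge.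
set X := ((J * M) ^ 2)%N.
pose G d m := (chi d * psi m)%:~R * rsqrt R m.
have -> : \sum_(1 <= d < X.+1) \sum_(1 <= e < X.+1 | (d * e <= X)%N)
    ((chi d * psi d)%:~R : R) * (psi e)%:~R * rsqrt R (d * e) =
    \sum_(1 <= m < X.+1) (psi m * divsum chi m)%:~R * rsqrt R m.
  (* Since [psi d * psi e = psi (d * e)], the pairs can be grouped by their product. *)
  transitivity (\sum_(1 <= d < X.+1) \sum_(1 <= e < X.+1 | (d * e <= X)%N) G d (d * e)%N).
    apply: eq_bigr => d _; apply: eq_bigr => e _.
    by rewrite /G -intrM (rcharM psiP) mulrA.
  rewrite sum_hyperbola_divisors; apply: eq_bigr => m _.
  by rewrite -mulr_suml -rmorph_sum /= -mulr_suml [_ * psi m]mulrC.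
have term_ge0 m : (0 < m)%N -> 0 <= psi m * divsum chi m.
  move=> m0; have [cop|/(rchar0 psiP) ->] := boolP (coprime m M); last by rewrite mul0r.
  have [->|dm] := eqVneq (divsum chi m) 0; first by rewrite mulr0.
  by rewrite (divsum_support chiP psiP psi1 m0 cop dm) mul1r (divsum_ge0 chiP).
have sq_inj : injective (fun j => (1 + j * M) ^ 2)%N.
  by move=> i j /eqP; rewrite eqn_exp2r // eqn_add2l eqn_pmul2r // => /eqP.
pose s := [seq ((1 + j * M) ^ 2)%N | j <- index_iota 0 J].
have lower : \sum_(m <- s) (psi m * divsum chi m)%:~R * rsqrt R m <=
    \sum_(1 <= m < X.+1) (psi m * divsum chi m)%:~R * rsqrt R m.
  apply: ler_sum_subseq.
  - exact: iota_uniq.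
  - by rewrite map_inj_uniq ?iota_uniq.
  - move=> m /mapP[j]; rewrite mem_index_iota => /andP[_ jJ] ->.
    rewrite mem_index_iota expn_gt0 ltnS leq_exp2r //.
    by apply: leq_trans (leq_mul jJ (leqnn M)); rewrite mulSn leq_add2r.
  - move=> m; rewrite mem_index_iota => /andP[m0 _].
    by rewrite mulr_ge0 ?rsqrt_ge0 // ler0z term_ge0.
apply: lt_le_trans (ler_norm _); apply: lt_le_trans lower.
have : \sum_(0 <= j < J) (M%:R : R)^-1 * (j.+1%:R)^-1 <=
    \sum_(m <- s) (psi m * divsum chi m)%:~R * rsqrt R m.
  rewrite big_map; apply: ler_sum => j _; rewrite rsqrt_sqr.
  apply: (@le_trans _ _ (1 + j * M)%:R^-1).
    rewrite -invfM -natrM lef_pV2 ?posrE ?ltr0n ?muln_gt0 ?M0 // ler_nat.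
    by rewrite mulnS mulnC leq_add2r.
  rewrite ler_peMl ?invr_ge0 // -[1]/(1%:~R) ler_int.
  have -> : psi ((1 + j * M) ^ 2)%N = 1.
    rewrite (rcharX psiP) (_ : psi _ = 1) ?expr1n // addnC rcharMD //.
    exact: rchar1 psiP.
  by rewrite mul1r (divsum_sqr_ge1 chiP).
apply: lt_le_trans; rewrite -mulr_sumr.
apply: lt_le_trans (ler_wpM2l _ (harmonic_ge R n)); last by rewrite invr_ge0.
rewrite -(ltr_pM2l (_ : 0 < (2 * M)%:R)) ?ltr0n ?muln_gt0 //.
have -> : (2 * M)%:R * (M%:R^-1 * (n%:R / 2)) = n%:R :> R.
  have : M%:R != 0 :> R by rewrite pnatr_eq0 -lt0n.
  by rewrite natrM => ?; field.
have -> : C = (M ^ 2 + 4 * M)%:R by rewrite natrD natrX natrM.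
by rewrite -natrM ltr_nat.
Qed.

(** * Quadratic reciprocity *)

Lemma Fp_nat_eq0 p n : prime p -> ((n%:R : 'F_p) == 0) = (p %| n)%N.
Proof. by move=> pp; rewrite -(dvdn_pcharf (pchar_Fp pp)). Qed.

Section GaussLemma.
Variables (p a : nat).
Hypotheses (pp : prime p) (op : odd p) (pa : ~~ (p %| a)%N).

Let r x := (a * x %% p)%N.
(** The absolute value of the residue of [a * x] of least absolute value. *)
Let s x := if (r x <= p./2)%N then r x else (p - r x)%N.

Let p_half : (p = p./2.*2.+1)%N.
Proof. by rewrite -[LHS]odd_double_half op. Qed.

Let r_bounds x : (0 < x <= p./2)%N -> (0 < r x < p)%N.
Proof.
case/andP=> x0 xh; rewrite /r ltn_mod (prime_gt0 pp) andbT lt0n -/(dvdn p _).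
rewrite Euclid_dvdM // (negPf pa) /= gtnNdvd //; lia.
Qed.

(** If [s x = s y] then [a * x] is [a * y] or [- a * y] modulo [p]. As [x + y < p], only [x = y]
    remains, and an injective map of a finite set to itself is a permutation. *)
Lemma gauss_perm : perm_eq [seq s x | x <- index_iota 1 p./2.+1] (index_iota 1 p./2.+1).
Proof.
have s_in x : (0 < x <= p./2)%N -> (0 < s x <= p./2)%N.
  by move/r_bounds; rewrite /s; move: (r x) => u; case: ifP; lia.
have s_inj : {in index_iota 1 p./2.+1 &, injective s}.
  move=> x y; rewrite !mem_index_iota !ltnS => hx hy sxy.
  have rxy : r x = r y \/ (r x + r y = p)%N.
    move: sxy (r_bounds hx) (r_bounds hy); rewrite /s.
    by move: (r x) (r y) => u v; do 2!case: ifP; lia.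
  (* Truncated subtraction makes [(x - y) + (y - x)] the distance between [x] and [y]. *)
  have {rxy} : (p %| a * (x - y) + a * (y - x))%N \/ (p %| a * (x + y))%N.
    case: rxy => [/eqP|rxy].
      left; have [xy|/ltnW yx] := leqP x y.
        rewrite (eqP (_ : x - y == 0)%N) ?subn_eq0 // muln0 add0n mulnBr -eqn_mod_dvd ?leq_mul //.
        by rewrite eq_sym.
      by rewrite (eqP (_ : y - x == 0)%N) ?subn_eq0 // muln0 addn0 mulnBr -eqn_mod_dvd ?leq_mul.
    by right; rewrite mulnDr /dvdn -modnDm -/(r x) -/(r y) rxy modnn.
  case; rewrite -?mulnDr Euclid_dvdM // (negPf pa) /= => /dvdn_leq; lia.
apply: uniq_perm; rewrite ?iota_uniq ?map_inj_in_uniq ?iota_uniq //.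
apply: (uniq_min_size _ _ _).2; rewrite ?size_map ?map_inj_in_uniq ?iota_uniq //.
by move=> _ /mapP[x + ->]; rewrite !mem_index_iota !ltnS => /s_in.
Qed.

Let mu := (\sum_(1 <= x < p./2.+1) (p./2 < r x))%N.

(** The product of the [a * x] over the half range is computed in two ways; by [gauss_perm] the
    factorial of [p./2] cancels. *)
Lemma gauss_lemma : (a%:R : 'F_p) ^+ p./2 = (-1) ^+ mu.
Proof.
have fact0 : \prod_(1 <= x < p./2.+1) (x%:R : 'F_p) != 0.
  rewrite prodf_seq_neq0; apply/allP => x; rewrite mem_index_iota => /andP[x0 xh].
  by rewrite Fp_nat_eq0 // gtnNdvd //; lia.
have fact_s : \prod_(1 <= x < p./2.+1) (x%:R : 'F_p) = \prod_(1 <= x < p./2.+1) (s x)%:R.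
  by rewrite -(perm_big _ gauss_perm) big_map.
apply: (mulIf fact0); rewrite [in RHS]fact_s.
rewrite -[X in _ ^+ X](subn1 p./2.+1) -prodr_const_nat -big_split /=.
rewrite /mu -prodrXr -big_split /= !big_nat.
apply: eq_bigr => x hx; have := r_bounds hx => /andP[_ rp].
have -> : a%:R * x%:R = (r x)%:R :> 'F_p.
  by rewrite -natrM [in LHS](divn_eq (a * x) p) natrD natrM pchar_Fp_0 // mulr0 add0r.
rewrite /s; case: leqP => _; first by rewrite mul1r.
by rewrite natrB 1?ltnW // pchar_Fp_0 // sub0r mulN1r opprK.
Qed.

Lemma odd_sum (I : Type) (l : seq I) (P : pred I) (F : I -> nat) :
  odd (\sum_(i <- l | P i) F i)%N = \big[addb/false]_(i <- l | P i) odd (F i).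
Proof. exact: (big_morph odd oddD). Qed.

Let odd_r x : odd (r x) = (odd a && odd x) (+) odd (a * x %/ p).
Proof. by rewrite -oddM {1}(divn_eq (a * x) p) oddD oddM op andbT addbAC addbb. Qed.

(** Modulo 2, with [p] odd, [s x] is [r x] plus the indicator of [p./2 < r x], and [r x] is [a * x]
    plus the quotient [a * x %/ p]. Summing uses that [s] permutes the half range. *)
Lemma gauss_parity : odd mu = odd (\sum_(1 <= x < p./2.+1) x)%N (+)
  (odd a && odd (\sum_(1 <= x < p./2.+1) x)%N) (+) odd (\sum_(1 <= x < p./2.+1) (a * x %/ p))%N.
Proof.
rewrite -[in X in _ = X (+) _ (+) _](perm_big _ gauss_perm) /= big_map !odd_sum.
rewrite (big_morph (andb (odd a)) (id1 := false) (op1 := addb)); last 2 first.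
- by move=> b c; rewrite andb_addr.
- by rewrite andbF.
rewrite -!big_split /= !big_nat; apply: eq_bigr => x /r_bounds/andP[_ /ltnW rp].
rewrite /s; case: leqP => _; last rewrite oddB // op addTb.
all: by rewrite odd_r /=; case: (odd a) (odd x) (odd (a * x %/ p)) => [] [] [].
Qed.
End GaussLemma.

Lemma euler_odd p a : prime p -> odd p -> ~~ (p %| a)%N -> odd a ->
  (a%:R : 'F_p) ^+ p./2 = (-1) ^+ (\sum_(1 <= x < p./2.+1) (a * x %/ p))%N.
Proof.
move=> pp op pa oa; rewrite gauss_lemma // -signr_odd -[RHS]signr_odd gauss_parity //.
by rewrite oa addbb.
Qed.

Lemma euler_two p : prime p -> odd p ->
  (2%:R : 'F_p) ^+ p./2 = (-1) ^+ (\sum_(1 <= x < p./2.+1) x)%N.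
Proof.
move=> pp op; have p2 : (p == p./2.*2.+1)%N by rewrite -[X in X == _]odd_double_half op.
have n2 : ~~ (p %| 2)%N.
  by apply/negP => /dvdn_leq -/(_ isT) p_le2; move: op (prime_gt1 pp); case: (p) p_le2 => [|[|[]]].
have quot0 : (\sum_(1 <= x < p./2.+1) (2 * x %/ p) = 0)%N.
  by rewrite big_nat big1 // => x /andP[_ xp]; apply: divn_small; lia.
by rewrite gauss_lemma // -signr_odd -[RHS]signr_odd gauss_parity // quot0 !addbF.
Qed.

Lemma floor_count m n k : (0 < m)%N -> (n %/ m <= k)%N ->
  (n %/ m = \sum_(1 <= y < k.+1) (m * y <= n))%N.
Proof.
move=> m0; under eq_bigr => y _ do rewrite mulnC -leq_divRL //.
move: (n %/ m)%N => q; elim: k q => [|k IH] q qk; first by rewrite big_geq //; lia.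
rewrite big_nat_recr //=; move: qk; rewrite leq_eqVlt => /orP[/eqP ->|qk].
  rewrite leqnn (eq_big_nat _ _ (F2 := fun=> 1%N)) ?sum_nat_const_nat; first by lia.
  by move=> i /andP[_ ik]; rewrite (ltnW ik).
by rewrite -IH // leqNgt qk addn0.
Qed.

(** Eisenstein's count: the two sums count the lattice points of a rectangle on either side of the
    diagonal, and coprimality keeps every point off it. *)
Lemma floor_sum_reciprocity p q : odd p -> odd q -> coprime p q ->
  (\sum_(1 <= x < p./2.+1) (q * x %/ p) + \sum_(1 <= y < q./2.+1) (p * y %/ q) = p./2 * q./2)%N.
Proof.
move=> op oq pq.
have hp : (p = p./2.*2.+1)%N by rewrite -[LHS]odd_double_half op.
have hq : (q = q./2.*2.+1)%N by rewrite -[LHS]odd_double_half oq.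
have count (m n : nat) : (m = m./2.*2.+1)%N -> (n = n./2.*2.+1)%N ->
    (\sum_(1 <= x < m./2.+1) (n * x %/ m) =
     \sum_(1 <= x < m./2.+1) \sum_(1 <= y < n./2.+1) (m * y <= n * x))%N.
  move=> hm hn; rewrite !big_nat; apply: eq_bigr => x /andP[_ xm].
  have m0 : (0 < m)%N by rewrite hm.
  apply: floor_count; rewrite // -ltnS ltn_divLR //.
  apply: (@leq_ltn_trans (n * m./2)); first by rewrite leq_mul2l -ltnS xm orbT.
  by move: hm hn; move: (m./2) (n./2) => h k -> ->; nia.
rewrite !count // [X in (_ + X)%N]exchange_big /= -big_split /=.
transitivity (\sum_(1 <= x < p./2.+1) q./2)%N; last by rewrite sum_nat_const_nat subn1 mulnC.
rewrite !big_nat; apply: eq_bigr => x /andP[x0 xp].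
transitivity (\sum_(1 <= y < q./2.+1) 1)%N; last by rewrite sum_nat_const_nat subn1 muln1.
rewrite -big_split /=.
rewrite !big_nat; apply: eq_bigr => y /andP[y0 yq].
have : (p * y != q * x)%N.
  apply/negP => /eqP e; have : (p %| q * x)%N by rewrite -e dvdn_mulr.
  by rewrite Gauss_dvdr // gtnNdvd //; lia.
by case: ltngtP.
Qed.

Lemma half_pred_prime p : prime p -> odd p -> (p.-1 = p./2 * 2)%N.
Proof. by move=> pp op; rewrite muln2 -[X in X.-1]odd_double_half op. Qed.

Section Legendre.
Variable p : nat.
Hypotheses (pp : prime p) (op : odd p).

(** The difference has absolute value at most 2, below the odd prime [p]. Identities between
    character values can thus be checked in ['F_p]. *)
Lemma Fp_intr_inj (u v : int) : `|u| <= 1 -> `|v| <= 1 -> u%:~R = v%:~R :> 'F_p -> u = v.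
Proof.
move=> u1 v1 /eqP; rewrite -subr_eq0 -rmorphB /= => h; apply/eqP; rewrite -subr_eq0.
have p2 : (2 < p)%N by rewrite odd_prime_gt2.
have : `|u - v|%N%:R == 0 :> 'F_p.
  by move: h; case: (intP (u - v)) => [|n|n] //;
    rewrite ?abszN ?rmorphN ?oppr_eq0 //= => h; rewrite absz_nat.
rewrite Fp_nat_eq0 // => /dvdn_leq dv; apply/eqP; lia.
Qed.

(** Euler's criterion serves as the definition, so multiplicativity comes from that of powers. *)
Definition legendre (c : nat) : int :=
  if (p %| c)%N then 0 else if (c%:R : 'F_p) ^+ p./2 == 1 then 1 else -1.

Lemma Fp_euler (x : 'F_p) : x != 0 -> (x ^+ p./2) ^+ 2 = 1.
Proof.
move=> x0; rewrite -exprM -half_pred_prime //; apply: (mulIf x0).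
rewrite mul1r -exprSr prednK ?prime_gt0 //.
by have := expf_card x; rewrite card_Fp.
Qed.

Lemma legendreE c : (legendre c)%:~R = (c%:R : 'F_p) ^+ p./2.
Proof.
rewrite /legendre -Fp_nat_eq0 //; have [->|c0] := eqVneq (c%:R : 'F_p) 0.
  by rewrite expr0n eqn0Ngt half_gt0 prime_gt1.
have := Fp_euler c0 => /eqP; rewrite sqrf_eq1; case: eqP => [->|_ /eqP ->] //.
Qed.

Lemma legendre_norm c : `|legendre c| <= 1.
Proof. by rewrite /legendre; case: ifP => // _; case: ifP. Qed.

Lemma legendre_rchar : rchar p legendre.
Proof.
split=> [m n|m|m|m].
- apply: Fp_intr_inj; rewrite ?normrM ?mulr_ile1 ?legendre_norm //.
  by rewrite rmorphM /= !legendreE natrM exprMn.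
- apply: Fp_intr_inj; rewrite ?legendre_norm //.
  by rewrite !legendreE natrD pchar_Fp_0 // addr0.
- rewrite coprime_sym prime_coprime // /legendre => /negPf ->.
  by case: ifP.
- by rewrite coprime_sym prime_coprime // negbK /legendre => ->.
Qed.
End Legendre.

Lemma prime_mul_ind (P : nat -> Prop) : P 1%N ->
    (forall p m, prime p -> (0 < m)%N -> P m -> P (p * m)%N) ->
  forall m, (0 < m)%N -> P m.
Proof.
move=> P1 PS; elim/ltn_ind => m IH m0.
have [m1|m1] := leqP m 1; first by have -> : m = 1%N by lia.
have /dvdnP[q Em] := pdiv_dvd m; have pp := pdiv_prime m1.
have q0 : (0 < q)%N by move: m0; rewrite Em muln_gt0 => /andP[].
rewrite Em mulnC; apply: PS => //; apply: IH => //.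
by rewrite [X in (_ < X)%N]Em ltn_Pmulr // prime_gt1.
Qed.

(** For a concrete table the two conditions are settled by evaluation. *)
Lemma rchar_table (M : nat) (f : nat -> int) : (0 < M)%N ->
    all (fun i => all (fun j => f (i * j %% M)%N == f i * f j) (iota 0 M)) (iota 0 M) ->
    all (fun i => if coprime i M then f i ^+ 2 == 1 else f i == 0) (iota 0 M) ->
  rchar M (fun c => f (c %% M)%N).
Proof.
move=> M0 fM fU; have in_iota m : (m %% M)%N \in iota 0 M by rewrite mem_iota ltn_mod.
split=> [m n|m|m cop|m cop].
- by have /eqP := allP (allP fM _ (in_iota m)) _ (in_iota n); rewrite modnMml modnMmr.
- by rewrite modnDr.
- by have := allP fU _ (in_iota m); rewrite coprime_modl cop => /eqP.
- by have := allP fU _ (in_iota m); rewrite coprime_modl (negPf cop) => /eqP.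
Qed.

Lemma rchar_mul M1 M2 f g : rchar M1 f -> rchar M2 g -> rchar (M1 * M2) (fun c => f c * g c).
Proof.
move=> fP gP; split=> [m n|m|m|m].
- by rewrite (rcharM fP) (rcharM gP) mulrACA.
- by rewrite addnC (rcharMD gP) mulnC (rcharMD fP).
- by rewrite coprimeMr => /andP[c1 c2]; rewrite exprMn (rchar_sqr fP) // (rchar_sqr gP).
- by rewrite coprimeMr negb_and => /orP[/(rchar0 fP)|/(rchar0 gP)] ->; rewrite ?mul0r ?mulr0.
Qed.

Lemma rchar_exp M f k : (0 < k)%N -> rchar M f -> rchar M (fun c => f c ^+ k).
Proof.
move=> k0 fP; split=> [m n|m|m cop|m cop].
- by rewrite (rcharM fP) exprMn.
- by rewrite (rcharD fP).
- by rewrite exprAC (rchar_sqr fP) // expr1n.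
- by rewrite (rchar0 fP) // expr0n -[(k == 0)%N]negbK -lt0n k0.
Qed.

(** This and the next two are the principal character modulo 2 and the quadratic symbols of -1 and
    of 2, tabulated by residue. *)
Definition parity_char (c : nat) : int := nth 0 [:: 0; 1] (c %% 2).
Definition neg1_char (c : nat) : int := nth 0 [:: 0; 1; 0; -1] (c %% 4).
Definition two_char (c : nat) : int := nth 0 [:: 0; 1; 0; -1; 0; -1; 0; 1] (c %% 8).

Lemma parity_rchar : rchar 2 parity_char. Proof. exact: rchar_table. Qed.
Lemma neg1_rchar : rchar 4 neg1_char. Proof. exact: rchar_table. Qed.
Lemma two_rchar : rchar 8 two_char. Proof. exact: rchar_table. Qed.

Lemma neg1_charE c : odd c -> neg1_char c = (-1) ^+ c./2.
Proof.
move=> oc; have [e|e] : (c %% 4 = 1 \/ c %% 4 = 3)%N by lia.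
all: rewrite /neg1_char e -signr_odd.
  by have -> : odd c./2 = false by lia.
by have -> : odd c./2 by lia.
Qed.

Lemma odd_sum_iota h : odd (\sum_(1 <= x < h.+1) x)%N = ((h %% 4)%N \in [:: 1; 2]%N).
Proof.
elim: h => [|h IH]; first by rewrite big_geq.
by rewrite big_nat_recr //= oddD IH !inE; lia.
Qed.

Lemma two_charE c : odd c -> two_char c = (-1) ^+ (\sum_(1 <= x < c./2.+1) x)%N.
Proof.
move=> oc; rewrite -signr_odd odd_sum_iota !inE.
have [e|[e|[e|e]]] : (c %% 8 = 1 \/ c %% 8 = 3 \/ c %% 8 = 5 \/ c %% 8 = 7)%N by lia.
all: rewrite /two_char e.
- by have -> : (c./2 %% 4 = 0)%N by lia.
- by have -> : (c./2 %% 4 = 1)%N by lia.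
- by have -> : (c./2 %% 4 = 2)%N by lia.
- by have -> : (c./2 %% 4 = 3)%N by lia.
Qed.

(** On primes, [chi] is the quadratic symbol of [D]. The coprimality clause says that [M] and
    [2 * |D|] have the same prime divisors; that [D] divides [M] allows congruences modulo [M] to be
    reduced modulo [D]. *)
Definition euler_char (D : int) (M : nat) (chi : nat -> int) : Prop :=
  [/\ (0 < M)%N, rchar M chi, (`|D| %| M)%N, forall m, coprime m M = coprime m (2 * `|D|) &
    forall l, prime l -> odd l -> ~~ (l %| `|D|)%N -> (chi l)%:~R = D%:~R ^+ l./2 :> 'F_l].

Lemma euler_char_mul D1 M1 chi1 D2 M2 chi2 :
  euler_char D1 M1 chi1 -> euler_char D2 M2 chi2 ->
  euler_char (D1 * D2) (M1 * M2) (fun c => chi1 c * chi2 c).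
Proof.
case=> M1_0 c1P dM1 cop1 E1 [M2_0 c2P dM2 cop2 E2]; split.
- by rewrite muln_gt0 M1_0.
- exact: rchar_mul.
- by rewrite abszM dvdn_mul.
- by move=> m; rewrite coprimeMr cop1 cop2 abszM !coprimeMr andbACA andbb.
- move=> l pl ol; rewrite abszM Euclid_dvdM // negb_or => /andP[l1 l2].
  by rewrite !rmorphM /= E1 // E2 // exprMn.
Qed.

Lemma euler_char_one : euler_char 1 2 parity_char.
Proof.
split=> //; first exact: parity_rchar.
move=> l _ ol _; rewrite expr1n /parity_char modn2 ol //.
Qed.

Lemma euler_char_neg1 : euler_char (-1) 4 neg1_char.
Proof.
split=> //; first exact: neg1_rchar.
  by move=> m; rewrite -[RHS]/(coprime m 2) -[4%N]/(2 ^ 2)%N coprime_pexpr.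
by move=> l _ ol _; rewrite neg1_charE // rmorphXn rmorphN1.
Qed.

Lemma euler_char_two : euler_char 2 8 two_char.
Proof.
split=> //; first exact: two_rchar.
  by move=> m; rewrite -[RHS]/(coprime m (2 ^ 2)) -[8%N]/(2 ^ 3)%N !coprime_pexpr.
by move=> l pl ol _; rewrite two_charE // rmorphXn rmorphN1 (euler_two pl ol).
Qed.

(** Quadratic reciprocity: the power of [neg1_char] is the sign relating the symbols of [l] modulo
    [p] and of [p] modulo [l]. *)
Lemma euler_char_odd_prime p : prime p -> odd p ->
  euler_char p (p * 4) (fun c => legendre p c * neg1_char c ^+ p./2).
Proof.
move=> pp op; split.
- by rewrite muln_gt0 prime_gt0.
- apply: rchar_mul; first exact: legendre_rchar.
  by apply: rchar_exp neg1_rchar; rewrite half_gt0 prime_gt1.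
- by rewrite absz_nat dvdn_mulr.
- by move=> m; rewrite absz_nat !coprimeMr -[4%N]/(2 ^ 2)%N coprime_pexpr // andbC.
move=> l pl ol; rewrite absz_nat => lp.
have pl' : ~~ (p %| l)%N by rewrite dvdn_prime2 // eq_sym -dvdn_prime2.
have cop : coprime p l by rewrite prime_coprime.
set A := (\sum_(1 <= x < p./2.+1) (l * x %/ p))%N.
have -> : legendre p l = (-1) ^+ A.
  apply: (Fp_intr_inj pp op); first exact: legendre_norm.
    by rewrite normrX normrN1 expr1n.
  by rewrite legendreE // rmorphXn rmorphN1 euler_odd.
(* The exponent becomes [A + (A + B)] with [B] the floor sum attached to [p] modulo [l], and only
   [B] matters for the sign. *)
rewrite neg1_charE // -exprM -exprD [(l./2 * _)%N]mulnC -(floor_sum_reciprocity op ol cop).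
rewrite addnA addnn exprD -mul2n exprM sqrrN !expr1n mul1r rmorphXn rmorphN1.
by rewrite -euler_odd.
Qed.

Lemma exists_euler_char (N : nat) : (0 < N)%N -> exists M chi, euler_char (- N%:Z) M chi.
Proof.
move=> N0; suff [M [chi H]] : exists M chi, euler_char N%:Z M chi.
  by exists (4 * M)%N, (fun c => neg1_char c * chi c); rewrite -mulN1r;
    exact: euler_char_mul euler_char_neg1 H.
move: N N0; apply: prime_mul_ind; first by exists 2%N, parity_char; exact: euler_char_one.
move=> p m pp m0 [M [chi H]]; rewrite PoszM.
have [op|ep] := boolP (odd p).
  by exists (p * 4 * M)%N, (fun c => (legendre p c * neg1_char c ^+ p./2) * chi c);
    apply: euler_char_mul H; exact: euler_char_odd_prime.
have -> : p = 2%N by case: (even_prime pp) => // op; rewrite op in ep.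
by exists (8 * M)%N, (fun c => two_char c * chi c); apply: euler_char_mul H; exact: euler_char_two.
Qed.

(** * Products of split primes *)

(** Excluded middle turns a property, such as being the class of a split product times a square,
    into a finite set. *)
Lemma finite_comprehension (T : finType) (P : T -> Prop) :
  exists A : {set T}, forall x, x \in A <-> P x.
Proof.
suff /fin_all_exists[b bP] : forall x, exists b : bool, b <-> P x.
  by exists [set x | b x] => x; rewrite inE.
by move=> x; case: (classic (P x)) => ?; [exists true|exists false].
Qed.

(* Take [K] maximal among the subgroups containing [H] and avoiding [c]. *)
Lemma exists_index2_avoiding (gT : finGroupType) (H : {group gT}) (c : gT) :
    abelian [set: gT] -> (forall u : gT, (u ^+ 2)%g \in H) -> c \notin H ->
  exists K : {group gT}, [/\ H \subset K, c \notin K &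
    forall u v, ((u * v)%g \in K) = ((u \in K) == (v \in K))].
Proof.
move=> abel sqH cH.
have [K /maxgroupP[/andP[cK HK] maxK] _] :=
  @maxgroup_exists gT (fun K => (c \notin K) && (H \subset K)) H (introT andP (conj cH (subxx _))).
have comm (u v : gT) : (u * v = v * u)%g by apply: (centsP abel); rewrite inE.
have sqK u : (u ^+ 2)%g \in K by apply: (subsetP HK).
(* By maximality [c = k * u ^ i] with [k] in [K]. Squares lie in [K] and [c] does not, so [i] is odd
   and [u * c] lies in [K]. *)
have outside u : u \notin K -> (u * c)%g \in K.
  move=> uK; pose L := (K <*> <[u]>)%G.
  have KL : K \subset L by exact: joing_subl.
  have uL : u \in L by rewrite (subsetP (joing_subr _ _)) ?cycle_id.
  have cL : c \in L.
    apply/negPn/negP => cL; case/negP: uK.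
    by rewrite -(maxK L) // cL (subset_trans HK KL).
  move: cL; rewrite /= cent_joinEr; last first.
    by rewrite (subset_trans (subsetT _)) // (subset_trans abel) // centS ?subsetT.
  case/mulsgP => k _ kK /cycleP[i ->] Ec; move: cK; rewrite Ec.
  have sqi j : (u ^+ (j * 2))%g \in K by rewrite mulnC expgM groupX.
  rewrite -[i]odd_double_half; case: (odd i) => /=; rewrite -muln2.
    rewrite expgD expg1 => _; rewrite [(k * _)%g]mulgA (comm k u) -(mulgA u k) !mulgA.
    rewrite -[(u * u)%g]/(u ^+ 2)%g.
    exact: groupM (groupM (sqK u) kK) (sqi _).
  by rewrite add0n (groupM kK (sqi _)).
exists K; split=> // u v.
have [uK|uK] := boolP (u \in K); first by rewrite groupMl //; case: (v \in K).
have [vK|vK] := boolP (v \in K); first by rewrite groupMr // (negPf uK).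
(* The product of [u * c] and [v * c] is [u * v] times a square. *)
have := groupM (outside _ uK) (outside _ vK).
rewrite -mulgA [(c * _)%g]mulgA [(c * v)%g]comm -mulgA mulgA -[(c * c)%g]expg2.
by rewrite groupMr // => ->.
Qed.

Section SplitPrimes.
Variables (M : nat) (chi : nat -> int).
Hypotheses (M1 : (1 < M)%N) (chiP : rchar M chi).
Local Notation U := {unit 'Z_M}.

(** If [m] is not coprime to [M] the value defaults to 1. *)
Definition Zunit (m : nat) : U := insubd (1%g : U) (m%:R : 'Z_M).

Lemma val_Zunit m : coprime m M -> val (Zunit m) = m%:R.
Proof. by move=> cop; rewrite insubdK // -topredE /= unitZpE // coprime_sym. Qed.

Lemma Zunit_eqmod m n : coprime m M -> coprime n M -> Zunit m = Zunit n -> m = n %[mod M].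
Proof.
move=> cm cn /(congr1 val); rewrite !val_Zunit // => /(congr1 val).
by rewrite /= !val_Zp_nat.
Qed.

Lemma ZunitM m n : coprime m M -> coprime n M -> Zunit (m * n) = (Zunit m * Zunit n)%g.
Proof.
by move=> cm cn; apply: val_inj; rewrite /= !val_Zunit ?coprimeMl ?cm // natrM.
Qed.

Lemma Zunit_mod m n : m = n %[mod M] -> Zunit m = Zunit n.
Proof.
by move=> e; rewrite /Zunit; congr insubd; apply: val_inj; rewrite /= !val_Zp_nat.
Qed.

Lemma Zunit_surj (u : U) : exists2 s : nat, coprime s M & Zunit s = u.
Proof.
have cop : coprime (val u : 'Z_M) M.
  by rewrite coprime_sym -unitZpE // natr_Zp; exact: valP u.
by exists (val u : 'Z_M) => //; apply: val_inj; rewrite val_Zunit // natr_Zp.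
Qed.

Definition split_prime (l : nat) := prime l /\ chi l = 1.

Lemma split_prime_coprime l : split_prime l -> coprime l M.
Proof. by case=> _ chi1; apply/negPn/negP => /(rchar0 chiP); rewrite chi1. Qed.

Inductive split_product : nat -> Prop :=
| split_product1 : split_product 1
| split_productM l q of split_prime l & split_product q : split_product (l * q).

Lemma split_product_coprime q : split_product q -> coprime q M.
Proof. by elim=> [|l q' /split_prime_coprime cl _ cq]; rewrite ?coprime1n // coprimeMl cl. Qed.

Lemma split_product_mul q r : split_product q -> split_product r -> split_product (q * r).
Proof. by elim=> [|l q' lP _ IH] rP; rewrite ?mul1n // -mulnA; constructor; auto. Qed.

(** The classes [q * s ^ 2] form a subgroup [A] containing all squares. If it missed [c], a subgroup
    [K] of index 2 above [A] avoiding [c] would define a real character [psi], and a split prime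
    with [psi p = -1] would lie outside [K] although its class is in [A]. *)
Lemma split_product_square_class c : coprime c M -> chi c = 1 ->
  exists q s, split_product q /\ (q * s ^ 2 = c %[mod M])%N.
Proof.
move=> cop chic.
pose good (u : U) := exists q s, [/\ split_product q, coprime s M & u = Zunit (q * s ^ 2)].
have [A AP] := finite_comprehension good.
have cop_qs q s : split_product q -> coprime s M -> coprime (q * s ^ 2) M.
  by move=> /split_product_coprime cq cs; rewrite coprimeMl cq coprimeXl.
have groupA : group_set A.
  apply/group_setP; split; first by apply/AP; exists 1%N, 1%N; split;
    [constructor|exact: coprime1n|apply: val_inj; rewrite val_Zunit ?coprime1n].
  move=> u v /AP[q [s [qP cs ->]]] /AP[r [t [rP ct ->]]]; apply/AP.
  exists (q * r)%N, (s * t)%N; split; first exact: split_product_mul.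
    by rewrite coprimeMl cs.
  by rewrite expnMn mulnACA [RHS]ZunitM //; exact: cop_qs.
have sqA u : (u ^+ 2)%g \in Group groupA.
  have [s cs <-] := Zunit_surj u; apply/AP; exists 1%N, s; split=> //; first by constructor.
  by rewrite mul1n -mulnn ZunitM // expg2.
suff /AP[q [s [qP cs /esym e]]] : Zunit c \in A.
  by exists q, s; split=> //; apply: Zunit_eqmod => //; exact: cop_qs.
apply/negPn/negP => cA.
have abelU : abelian [set: U] by exact: units_Zp_abelian.
have [K [AK cK KM]] := exists_index2_avoiding abelU sqA cA.
pose psi m : int := if coprime m M then if Zunit m \in K then 1 else -1 else 0.
have psiP : rchar M psi.
  split=> [m n|m|m cm|m cm]; rewrite /psi.
  - rewrite coprimeMl; case: (boolP (coprime m M)) => cm; last by rewrite mul0r.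
    case: (boolP (coprime n M)) => cn /=; last by rewrite mulr0.
    by rewrite ZunitM // KM; do 2!case: (_ \in K).
  - by rewrite -coprime_modl modnDr coprime_modl (@Zunit_mod (m + M) m) // modnDr.
  - by rewrite cm; case: ifP.
  - by rewrite (negPf cm).
have psic : psi c = -1 by rewrite /psi cop (negPf cK).
have [p [pp chip psip]] : exists p, [/\ prime p, chi p = 1 & psi p = -1].
  (* As [chi c = 1] and [psi c = -1], the same [c] shows that both [psi] and [chi * psi] take the
     value -1. *)
  by apply: (exists_prime_separating (ltnW M1) chiP psiP); exists c; rewrite // chic mul1r.
have cp : coprime p M by apply: split_prime_coprime.
suff pK : Zunit p \in K by move: psip; rewrite /psi cp pK.
apply: (subsetP AK); apply/AP; exists p, 1%N; split; rewrite ?coprime1n ?muln1 //.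
by rewrite -[p]muln1; constructor => //; constructor.
Qed.
End SplitPrimes.

(** * Square roots of [- N] modulo split products *)

Lemma euler_criterion p (x : 'F_p) : prime p -> odd p -> x ^+ p./2 = 1 -> exists y, x = y ^+ 2.
Proof.
move=> pp op xh; have h0 : (0 < p./2)%N by rewrite half_gt0 prime_gt1.
have Ux : x \is a GRing.unit.
  rewrite unitfE; apply: contra_eq_neq xh => ->.
  by rewrite expr0n eqn0Ngt h0 eq_sym oner_eq0.
pose u : {unit 'F_p} := Sub x Ux.
have /cyclicP[g gE] := field_unit_group_cyclic [group of [set: {unit 'F_p}]].
have /cycleP[i ui] : u \in <[g]>%g by rewrite -gE inE.
have og : #[g]%g = (p./2 * 2)%N by rewrite /order -gE card_finField_unit card_Fp // half_pred_prime.
have : (u ^+ p./2)%g = 1%g by apply: val_inj; rewrite FinRing.val_unitX.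
(* The unit group is cyclic of order [2 * p./2], so [u = g ^ i] with [u ^ p./2 = 1] forces [i] to be
   even. *)
rewrite ui -expgM => /eqP; rewrite -order_dvdn og mulnC dvdn_pmul2r // => /dvdnP[j ij].
exists (val (g ^+ j)%g); rewrite -FinRing.val_unitX -expgM -ij -ui //.
Qed.

Lemma exists_sqrt_neg_prime N l : prime l -> odd l ->
  ((- N%:Z)%:~R : 'F_l) ^+ l./2 = 1 -> exists b, (l %| b ^ 2 + N)%N.
Proof.
move=> pl ol /(euler_criterion pl ol)[y Ny]; exists (y : nat).
rewrite -(Fp_nat_eq0 _ pl) natrD natrX natr_Zp -Ny rmorphN addNr //.
Qed.

Lemma dvdn_sqr_add_mod q N a b : (a = b %[mod q])%N -> (q %| b ^ 2 + N)%N -> (q %| a ^ 2 + N)%N.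
Proof. by move=> e; rewrite /dvdn -modnDml -modnXm -e modnXm modnDml. Qed.

(** The Chinese remainder theorem if [l] does not divide [q], and a Hensel lift of [a] otherwise. *)
Lemma sqrt_neg_mul N q l a b : (0 < q)%N -> prime l -> odd l -> ~~ (l %| N)%N ->
  (q %| a ^ 2 + N)%N -> (l %| b ^ 2 + N)%N -> exists c, (l * q %| c ^ 2 + N)%N.
Proof.
move=> q0 pl ol lN qa lb; have [lq|lq] := boolP (l %| q)%N; last first.
  have cop : coprime l q by rewrite prime_coprime.
  exists (chinese l q b a); rewrite Gauss_dvd //; apply/andP; split.
    by apply: dvdn_sqr_add_mod lb; rewrite chinese_modl.
  by apply: dvdn_sqr_add_mod qa; rewrite chinese_modr.
have /dvdnP[t Et] := qa.
have la : coprime l (2 * a).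
  rewrite coprimeMr !prime_coprime // (dvdn_prime2 pl) //; apply/andP; split.
    by apply: contraTN ol => /eqP ->.
  apply: contra lN => dvd_la; have la2 : (l %| a ^ 2)%N by rewrite -mulnn dvdn_mulr.
  by rewrite -(dvdn_addr _ la2) (dvdn_trans lq).
(* Here [s] is minus an inverse of [2 * a] modulo [l]; with [a ^ 2 + N = t * q], the correction
   [q * s * t] cancels [t] modulo [l]. *)
have [s _] := Bezoutl (2 * a) (prime_gt0 pl); rewrite (eqP la) => ls.
exists (a + q * (s * t))%N.
have -> : ((a + q * (s * t)) ^ 2 + N =
    (a ^ 2 + N) + q * (2 * a * s * t + q * (s * t) ^ 2))%N by ring.
have -> : (a ^ 2 + N + q * (2 * a * s * t + q * (s * t) ^ 2) =
    ((1 + s * (2 * a)) * t + q * (s * t) ^ 2) * q)%N by rewrite Et; ring.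
by rewrite dvdn_pmul2r // dvdn_add ?dvdn_mulr.
Qed.

Lemma exists_sqrt_neg_split (N M : nat) chi q : (0 < N)%N -> euler_char (- N%:Z) M chi ->
  split_product chi q -> exists b, (q %| b ^ 2 + N)%N.
Proof.
move=> N0 [_ chiP _ cop E]; elim=> [|l r lP rP [a ra]]; first by exists 0%N; rewrite dvd1n.
have cl := split_prime_coprime chiP lP; case: lP => pl chil.
have cr := split_product_coprime chiP rP.
move: cl; rewrite cop abszN absz_nat prime_coprime // Euclid_dvdM // negb_or => /andP[l2 lN].
have ol : odd l by case: (even_prime pl) => // e2; rewrite e2 in l2.
have [b lb] : exists b, (l %| b ^ 2 + N)%N.
  by apply: exists_sqrt_neg_prime; rewrite // -E ?chil // abszN absz_nat.
apply: sqrt_neg_mul lN ra lb => //; rewrite lt0n; apply: contraTneq cr => ->.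
by rewrite cop /coprime gcd0n abszN absz_nat neq_ltn; apply/orP; right; lia.
Qed.

Lemma rchar_eq_on_primes M1 M2 f g c : rchar M1 f -> rchar M2 g -> (0 < c)%N ->
  (forall l, prime l -> (l %| c)%N -> f l = g l) -> f c = g c.
Proof.
move=> fP gP; move: c; apply: prime_mul_ind; first by rewrite (rchar1 fP) (rchar1 gP).
move=> p m pp m0 IH H; rewrite (rcharM fP) (rcharM gP) H ?dvdn_mulr // IH // => l pl lm.
by apply: H; rewrite // dvdn_mull.
Qed.

(** Comparison at each prime divisor of [c] is enough; this evaluates [chi c] without knowing the
    factorization of [c]. *)
Lemma euler_char_eq D M chi D' M' chi' c : euler_char D M chi -> euler_char D' M' chi' ->
    (0 < c)%N -> odd c -> coprime c `|D| -> coprime c `|D'| ->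
    (forall l, prime l -> odd l -> (l %| c)%N -> (D%:~R : 'F_l) ^+ l./2 = D'%:~R ^+ l./2) ->
  chi c = chi' c.
Proof.
move=> [_ cP _ _ E] [_ c'P _ _ E'] c0 oc cD cD' H; apply: (rchar_eq_on_primes cP c'P c0) => l pl lc.
have ol : odd l by exact: dvdn_odd lc oc.
apply: (Fp_intr_inj pl ol); [exact: rchar_norm cP l|exact: rchar_norm c'P l|].
have ndvd d : coprime c d -> ~~ (l %| d)%N.
  by move=> cd; rewrite -prime_coprime //; exact: coprime_dvdl lc cd.
by rewrite E ?ndvd // E' ?ndvd // H.
Qed.

(** * Target residues and the unimodular form *)

Lemma coprime_of_mul_add1 c N j k : (j * N = k * c + 1)%N -> coprime c N.
Proof.
move=> e; apply: (@coprime_dvdr _ (j * N)); first exact: dvdn_mull.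
by rewrite e /coprime gcdnMDl gcdn1.
Qed.

(** Modulo every prime divisor of [c], [- N] is -1, and -1 has symbol 1 at [c] because [c] is 1
    modulo 4. *)
Lemma target_neg1 N M chi c k : euler_char (- N%:Z) M chi -> (N = k * c + 1)%N ->
  (c %% 4 = 1)%N -> coprime c M /\ chi c = 1.
Proof.
move=> H e c4; have oc : odd c by lia.
have cN : coprime c N by apply: (@coprime_of_mul_add1 _ _ 1 k); rewrite mul1n.
have [_ _ _ cop _] := H; rewrite cop abszN absz_nat coprimeMr coprimen2 oc cN; split=> //.
have -> : 1 = neg1_char c by rewrite /neg1_char c4.
apply: (euler_char_eq H euler_char_neg1) => //; [lia|by rewrite abszN absz_nat|exact: coprimen1|].
move=> l pl ol lc; congr (_ ^+ _); rewrite !rmorphN; congr (- _).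
have /eqP l0 : (c%:R : 'F_l) == 0 by rewrite (Fp_nat_eq0 _ pl).
by rewrite -[LHS]/(N%:R) e natrD natrM l0 mulr0 add0r.
Qed.

(** Modulo every prime divisor of [c], [2 * N] is 1, so [- N] differs from -2 by the square factor
    4; the symbol of -2 at [c] is 1 because [c] is 1 modulo 8. *)
Lemma target_neg2 N M chi c : euler_char (- N%:Z) M chi -> (2 * N = c + 1)%N ->
  (c %% 8 = 1)%N -> coprime c M /\ chi c = 1.
Proof.
move=> H e c8; have oc : odd c by lia.
have cN : coprime c N by apply: (@coprime_of_mul_add1 _ _ 2 1); rewrite mul1n.
have [_ _ _ cop _] := H; rewrite cop abszN absz_nat coprimeMr coprimen2 oc cN; split=> //.
have c4 : (c %% 4 = 1)%N by lia.
have -> : 1 = neg1_char c * two_char c by rewrite /neg1_char /two_char c4 c8.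
apply: (euler_char_eq H (euler_char_mul euler_char_neg1 euler_char_two)) => //.
- by lia.
- by rewrite abszN absz_nat.
- by rewrite -[X in coprime c X]/2%N coprimen2.
move=> l pl ol lc; have /eqP l0 : (c%:R : 'F_l) == 0 by rewrite (Fp_nat_eq0 _ pl).
have N2 : N%:R * 2 = 1 :> 'F_l by rewrite -natrM mulnC e natrD l0 add0r.
have two0 : 2%:R != 0 :> 'F_l.
  by apply: contra_eq_neq N2 => ->; rewrite mulr0 eq_sym oner_eq0.
transitivity (((- N%:Z)%:~R : 'F_l) ^+ l./2 * (2%:R ^+ l./2) ^+ 2).
  by rewrite (Fp_euler pl ol two0) mulr1.
rewrite exprAC -exprMn; congr (_ ^+ _).
have -> : (- N%:Z)%:~R = - N%:R :> 'F_l by rewrite rmorphN.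
have -> : (-1 * 2)%:~R = - 2%:R :> 'F_l by rewrite mulN1r rmorphN.
by rewrite mulNr expr2 mulrA N2 mul1r.
Qed.

Lemma exists_form_of_target N M chi c : (0 < N)%N -> euler_char (- N%:Z) M chi ->
    coprime c M -> chi c = 1 ->
  exists q b v, [/\ odd q, (q %| b ^ 2 + N)%N & (q * v ^ 2 = c %[mod N])%N].
Proof.
move=> N0 H cM chic; have [M0 chiP NM cop _] := H.
have M1 : (1 < M)%N.
  have := cop 0%N; rewrite /coprime !gcd0n abszN absz_nat; lia.
have [q [v [qP qv]]] := split_product_square_class M1 chiP cM chic.
have [b qb] := exists_sqrt_neg_split N0 H qP.
exists q, b, v; split=> //.
  have := split_product_coprime chiP qP; rewrite cop coprimeMr coprimen2 => /andP[] //.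
have NM' : (N %| M)%N by move: NM; rewrite abszN absz_nat.
by rewrite -[LHS](modn_dvdm _ NM') qv modn_dvdm.
Qed.

(** The target [c] must satisfy [c = -1] modulo [N]: it is [2 * N - 1] or [N - 1] according to [N]
    modulo 4. For [N] equal to 3 modulo 8 it is [N./2], where [2 * c = -1] modulo [N], and the
    leading coefficient is doubled. *)
Lemma exists_unimodular_form N : (0 < N)%N ->
    (N %% 4 = 1 \/ N %% 4 = 2 \/ N %% 8 = 3)%N ->
  exists q b v : nat, [/\ (0 < q)%N, (q %| b ^ 2 + N)%N & (N %| q * v ^ 2 + 1)%N].
Proof.
move=> N0 HN; have [M [chi H]] := exists_euler_char N0.
have dvd_of c x : (x = c %[mod N])%N -> (N %| c + 1)%N -> (N %| x + 1)%N.
  by move=> e; rewrite /dvdn -modnDml -e modnDml.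
case: HN => [N4|[N4|N8]].
- have [cM chic] : coprime (2 * N - 1) M /\ chi (2 * N - 1)%N = 1.
    by apply: (target_neg2 H); lia.
  have [q [b [v [oq qb qv]]]] := exists_form_of_target N0 H cM chic.
  exists q, b, v; split; rewrite ?odd_gt0 //; apply: dvd_of qv _.
  by rewrite subnK ?dvdn_mull // muln_gt0.
- have [cM chic] : coprime (N - 1) M /\ chi (N - 1)%N = 1.
    by apply: (target_neg1 (k := 1) H); lia.
  have [q [b [v [oq qb qv]]]] := exists_form_of_target N0 H cM chic.
  by exists q, b, v; split; rewrite ?odd_gt0 //; apply: dvd_of qv _; rewrite subnK.
- have oN : odd N by lia.
  have [cM chic] : coprime (N./2) M /\ chi (N./2)%N = 1.
    by apply: (target_neg1 (k := 2) H); lia.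
  have [q [b [v [oq qb qv]]]] := exists_form_of_target N0 H cM chic.
  (* An odd [b'] makes [b' ^ 2 + N] even, hence divisible by [2 * q]; adding the odd [q] corrects
     the parity of [b]. *)
  have [b' [ob' qb']] : exists b', odd b' /\ (q %| b' ^ 2 + N)%N.
    have [ob|eb] := boolP (odd b); first by exists b.
    exists (b + q)%N; split; first by rewrite oddD oq (negPf eb).
    by apply: dvdn_sqr_add_mod qb; rewrite modnDr.
  exists (2 * q)%N, b', v; split; first by rewrite muln_gt0 /= odd_gt0.
    by rewrite Gauss_dvd ?coprime2n // qb' andbT dvdn2 oddD oddX ob' oN.
  have -> : (2 * q * v ^ 2 + 1 = 2 * (q * v ^ 2) + 1)%N by rewrite mulnA.
  apply: (@dvd_of (2 * N./2)%N); first by rewrite -modnMmr qv modnMmr.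
  by rewrite addn1 mul2n -[X in (X %| _)%N]odd_double_half oN.
Qed.

Unset Implicit Arguments.
Open Scope Z_scope.

(** * Universality *)

(** The quotients [h] and [w] of the two divisibilities complete the matrix, and
    [w * N - q * v ^ 2 = 1] is its determinant. *)
Lemma three_squares_nat (N : nat) : (0 < N)%N ->
    (N %% 4 = 1 \/ N %% 4 = 2 \/ N %% 8 = 3)%N ->
  three_squares (Z.of_nat N).
Proof.
move=> N0 /(exists_unimodular_form N0)[q [b [v [q0 /dvdnP[h qh] /dvdnP[w Nw]]]]].
have -> : Z.of_nat N = Z.of_nat q * Z.of_nat h - Z.of_nat b * Z.of_nat b by lia.
apply: (@three_squares_of_ternary _ _ _ (Z.of_nat v) (Z.of_nat w)); lia.
Qed.

Lemma ternary_rep_good (t : Z) : 0 < t -> ternary_good t -> ternary_rep t.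
Proof.
move=> t0 Ht; apply: ternary_rep_of_three_squares.
have [k Hk] : exists k, t = 8 * k + 1 \/ t = 8 * k + 2 \/ t = 8 * k + 3 \/ t = 8 * k + 6 \/
    t = 8 * k + 7 by exists (t / 8); unfold ternary_good in Ht; Z.div_mod_to_equations; lia.
have [N EN] : exists N, Z.of_nat N = 3 * t by exists (Z.to_nat (3 * t)); lia.
by rewrite -EN; apply: three_squares_nat; lia.
Qed.

Lemma represents_not_mod_4 (b n : Z) : 1 <= b <= 5 -> 0 < n -> n mod 4 <> 0 -> represents 1 b n.
Proof.
  intros Hb Hn H4.
  assert (Hgood : ternary_good n \/ n mod 8 = 5)
    by (unfold ternary_good; Z.div_mod_to_equations; lia).
  destruct Hgood as [Hgood | H5].
  { apply (represents_sub b n 0); replace (n - b * 0 ^ 2) with n by ring.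
    apply ternary_rep_good; assumption. }
  (* For [n] equal to 5 modulo 8, the choices [y = 2, 1, 1, 1, 2] for [b = 1, ..., 5] leave
     [n - b * y ^ 2] equal to 1, 3, 2, 1, 1 modulo 8. *)
  assert (b = 1 \/ b = 2 \/ b = 3 \/ b = 4 \/ b = 5) as [-> | [-> | [-> | [-> | ->]]]] by lia;
    [apply (represents_sub 1 n 2) | apply (represents_sub 2 n 1) | apply (represents_sub 3 n 1)
    | apply (represents_sub 4 n 1) |];
    try (apply ternary_rep_good; unfold ternary_good; Z.div_mod_to_equations; lia).
  (* For [b = 5] the choice [y = 2] subtracts 20, so 5 and 13 are represented directly, as [5] and
     [5 + 2 * 4]. *)
  assert (n = 5 \/ n = 13 \/ 20 < n) as [-> | [-> | Hn']] by (Z.div_mod_to_equations; lia).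
  - exists 0, 1, 0, 0; reflexivity.
  - exists 0, 1, 2, 0; reflexivity.
  - apply (represents_sub 5 n 2), ternary_rep_good;
      unfold ternary_good; Z.div_mod_to_equations; lia.
Qed.

Lemma represents_all (b n : Z) : 1 <= b <= 5 -> 0 <= n -> represents 1 b n.
Proof.
  intros Hb; induction n as [n IH] using (well_founded_induction (Z.lt_wf 0)); intros Hn.
  destruct (Z.eq_dec n 0) as [-> | Hn0]; [exists 0, 0, 0, 0; unfold f2; ring |].
  destruct (Z.eq_dec (n mod 4) 0) as [H4 | H4]; [| apply represents_not_mod_4; lia].
  apply Z_div_exact_full_2 in H4; [| lia].
  destruct (IH (n / 4)) as (x & y & z & w & H);
    [Z.div_mod_to_equations; lia | Z.div_mod_to_equations; lia |].
  exists (2 * x), (2 * y), (2 * z), (2 * w); rewrite H4 -H; unfold f2; ring.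
Qed.

Theorem theorem4p2 (a b : Z) (ha : 0 < a) (hab : a <= b)
  (h1 : represents a b 1) (h5 : represents a b 5) :
  forall n : Z, 0 <= n -> represents a b n.
Proof.
have [-> Hb] := coefficients_bound _ _ ha hab h1 h5.
by move=> n; apply: represents_all.
Qed.
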